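(* Let $p\ge7$ be an integer and let $$a_*=\frac{-3p+4+\sqrt{9p^2-8p+48}}{4}.$$ Then $a_*\in(0,1)$, and $a_*$ is the smallest number $a\in(0,1)$ satisfying $-p/2\le a<p/2-2$ and $$\frac{p+2a+2}{3p/2+a}\le a<1 .$$ Moreover, the Bayes estimator of $\beta$ with respect to the prior $\pi(\kappa)=\kappa^{a_*-1}(1-\kappa)^{a_*-1}$, $\kappa\in(0,1)$, is minimax for estimating $\beta$ from $y\sim N_p(\beta,I_p)$ under quadratic loss $\|\hat\beta-\beta\|^2$.
   Context: Model: $y\mid\beta\sim N_p(\beta,I_p)$, $\beta\mid\kappa\sim N_p(0,\kappa^{-1}(1-\kappa)I_p)$, $\kappa\sim\pi(\kappa)$ on $(0,1)$ ($\pi$ taken up to a normalizing constant). The Bayes estimator with respect to $\pi$ is $$\hat\beta(y)=\left(1-\frac{\int_0^1\kappa^{p/2+1}\exp(-\kappa\|y\|^2/2)\pi(\kappa)\,\mathrm{d}\kappa}{\int_0^1\kappa^{p/2}\exp(-\kappa\|y\|^2/2)\pi(\kappa)\,\mathrm{d}\kappa}\right)y .$$ The risk of an estimator $\delta$ is $E_\beta\|\delta(Y)-\beta\|^2$ with $Y\sim N_p(\beta,I_p)$. An estimator is minimax if it minimizes the supremum over $\beta\in\mathbb{R}^p$ of the risk among all estimators; the minimax value is $p$, so $\delta$ is minimax if and only if $E_\beta\|\delta(Y)-\beta\|^2\le p$ for all $\beta\in\mathbb{R}^p$. *)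

(* Defs.v *)
From HB Require Import structures.
From mathcomp Require Import all_boot all_order all_algebra.
From mathcomp Require Import all_classical all_reals all_analysis.

Set Implicit Arguments.
Unset Strict Implicit.
Unset Printing Implicit Defensive.

Import Order.TTheory GRing.Theory Num.Theory.
Import numFieldNormedType.Exports.

Local Open Scope classical_set_scope.
Local Open Scope ring_scope.

(* Vectors of R^p are p-tuples, because the library equips tuples (and not row
   vectors) with the product sigma-algebra. *)
Notation vec R p := (p.-tuple (measurableTypeR R)).

Definition sqnorm (R : realType) (p : nat) (x : vec R p) : R :=
  \sum_(i < p) tnth x i ^+ 2.

Definition vsub (R : realType) (p : nat) (x y : vec R p) : vec R p :=
  [tuple tnth x i - tnth y i | i < p].

Definition vscale (R : realType) (p : nat) (c : R) (x : vec R p) : vec R p :=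
  [tuple c * tnth x i | i < p].

Definition vcons (R : realType) (p : nat) (z : measurableTypeR R * vec R p) :
  vec R p.+1 := [tuple of z.1 :: z.2].

Lemma measurable_vcons (R : realType) (p : nat) :
  measurable_fun [set: measurableTypeR R * vec R p] (@vcons R p).
Proof. by apply: measurable_cons. Qed.

HB.instance Definition _ (R : realType) (p : nat) :=
  isMeasurableFun.Build _ _ _ _ (@vcons R p) (@measurable_vcons R p).

(* The law N_p(b, I_p), as the product of the laws N(b_i, 1). *)
Fixpoint mvnormal (R : realType) (p : nat) : vec R p -> probability (vec R p) R :=
  match p with
  | 0 => fun b => \d_b
  | n.+1 => fun b =>
      distribution (normal_prob (thead b) 1 \x mvnormal [tuple of behead b])%E
        (@vcons R n)
  end.

Lemma mvnormal_box (R : realType) (p : nat) (b : vec R p)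
    (A : 'I_p -> set (measurableTypeR R)) :
  (forall i, measurable (A i)) ->
  mvnormal b [set x | forall i, A i (tnth x i)] =
  (\prod_(i < p) normal_prob (tnth b i) 1 (A i))%E.
Proof.
elim: p b A => [|p ih] b A mA.
  rewrite big_ord0 /= (_ : [set x | _] = setT) ?diracT//.
  by apply/seteqP; split=> // x _ [].
rewrite big_ord_recl /=.
rewrite [LHS](_ : _ =
  (normal_prob (thead b) 1 \x mvnormal [tuple of behead b])%E
    (A ord0 `*` [set x | forall i, A (lift ord0 i) (tnth x i)])); last first.
  rewrite /distribution /pushforward; congr (_ _).
  apply/seteqP; split=> [[u v] /= h|[u v] /= [h0 h] i].
    split; first by have := h ord0; rewrite tnth0.
    by move=> i; have := h (lift ord0 i); rewrite tnthS.
  by case: (unliftP ord0 i) => [j ->|->]; rewrite ?tnthS ?tnth0//; exact: h.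
rewrite product_measure1E//.
  congr (_ * _)%E.
  rewrite [LHS](ih _ (fun i => A (lift ord0 i)))//; apply: eq_bigr => i _.
  rewrite (_ : tnth [tuple of behead b] i = tnth b (lift ord0 i))//.
  by case/tupleP: b => x t; rewrite tnthS; congr tnth; apply/val_inj.
rewrite (_ : mkset _ = \bigcap_(i in [set: 'I_p])
    ((@tnth p _)^~ i @^-1` A (lift ord0 i))); last first.
  by apply/seteqP; split=> x /= h i; [move=> _|]; exact: h.
apply: fin_bigcap_measurable; first exact: finite_finset.
by move=> i _; rewrite -[X in measurable X]setTI; exact: measurable_tnth.
Qed.

(* E_b |delta(Y) - b|^2 for Y ~ N_p(b, I_p); possibly +oo. *)
Definition risk (R : realType) (p : nat) (delta : vec R p -> vec R p)
    (b : vec R p) : \bar R :=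
  (\int[mvnormal b]_y (sqnorm (vsub (delta y) b))%:E)%E.

Definition sup_risk (R : realType) (p : nat) (delta : vec R p -> vec R p) :
  \bar R := ereal_sup (range (risk delta)).

(* Estimators are the measurable maps from R^p to R^p. *)
Definition minimax (R : realType) (p : nat) (delta : vec R p -> vec R p) : Prop :=
  measurable_fun setT delta /\
  forall delta' : vec R p -> vec R p, measurable_fun setT delta' ->
    (sup_risk delta <= sup_risk delta')%E.

(* The integral of k^q exp(-k |y|^2 / 2) pi(k) over (0, 1). As with any
   Rintegral, it is meaningful only if the integrand is integrable. *)
Definition kappa_int (R : realType) (p : nat) (prior : R -> R) (q : R)
    (y : vec R p) : R :=
  \int[lebesgue_measure]_(k in `]0, 1[)
    (k `^ q * expR (- (k * sqnorm y / 2)) * prior k).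

(* The posterior mean 1 - E[kappa | y], times y; any normalizing constant of
   the prior cancels. *)
Definition bayes_estimator (R : realType) (p : nat) (prior : R -> R)
    (y : vec R p) : vec R p :=
  vscale (1 - kappa_int prior (p%:R / 2 + 1) y / kappa_int prior (p%:R / 2) y) y.

Definition a_star (R : realType) (p : nat) : R :=
  (- 3 * p%:R + 4 + Num.sqrt (9 * p%:R ^+ 2 - 8 * p%:R + 48)) / 4.

Definition admissible (R : realType) (p : nat) (a : R) : Prop :=
  [/\ 0 < a < 1, - (p%:R / 2) <= a < p%:R / 2 - 2 &
      (p%:R + 2 * a + 2) / (3 * p%:R / 2 + a) <= a < 1].

(* Main.v *)
(* For the prior k^(a-1) (1-k)^(a-1), put A = p/2 + a, w = |y|^2 and
   I_j(w) = int_0^1 k^(A+j-1) (1-k)^(a-1) exp(-k w/2) dk.  The Bayes estimator is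
   (1 - phi(w)) y with phi = I_1/I_0, and Stein's identity bounds its risk by p as
   soon as
     2 w I_2 I_0 - w I_1^2 <= 2 p I_1 I_0.
   Integration by parts gives the recurrence
     (w/2) (I_{j+1} - I_{j+2}) = (A+j) I_j - (A+j+a) I_{j+1},
   from which a (w/2) I_{j+1} <= (A+j) I_j follows by downward induction on j.  If
   w I_1 >= 2 A I_0, the case j = 1 of this bound suffices, because the condition
   defining a_star reads 2 (A+1) <= a (p+A); if w I_1 < 2 A I_0, the recurrence and
   I_2 <= I_1 suffice, because A + 2 a <= p.
   Conversely the supremum of the risk of any estimator is at least its average
   over b ~ N(0, tau^2 I_p), which is at least p tau^2 / (1 + tau^2). *)

Require Import Defs.
From mathcomp Require Import all_boot all_order all_algebra.
From mathcomp Require Import all_classical all_reals all_analysis.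
From mathcomp Require Import measurable_realfun ring lra.

Set Implicit Arguments.
Unset Strict Implicit.
Unset Printing Implicit Defensive.

Import Order.TTheory GRing.Theory Num.Theory.
Import numFieldNormedType.Exports.

Local Open Scope classical_set_scope.
Local Open Scope ring_scope.

(** * Integration against product normal laws *)

(** The risk may be infinite and is taken against a product law defined by recursion, so identities
    are arranged for nonnegative integrands, where Tonelli needs no integrability. Both halves rest
    on one device: two one-dimensional Gaussian integrands with the same integral differ by the
    derivative of an explicit function with Gaussian decay. No Gaussian moment is evaluated. This
    gives the posterior variance in the lower bound and Stein's identity in the upper bound;
    resampling a single coordinate carries both to dimension p. Differentiating I_j in w gives
    -I_{j+1}/2, hence phi' = (I_1^2 - I_0 I_2) / (2 I_0^2). Multiplying Stein's expression -2 p phi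
    - 4 w phi' + w phi^2 by I_0^2 then produces the inequality between I_0, I_1 and I_2. Since
    a_star < 1, the weight (1-k)^(a-1) is unbounded at 1, so integrability and boundary terms on ]0,
    1[ are obtained by exhausting it with compact intervals. The downward induction can start
    because its bound is direct once j exceeds a w/2. *)

Section integral_density.
Local Open Scope ereal_scope.
Context d (T : measurableType d) (R : realType).
Variables (mu nu : {measure set T -> \bar R}) (g : T -> R).
Hypothesis mg : measurable_fun setT g.
Hypothesis g0 : forall x, (0 <= g x)%R.
Hypothesis nuE : forall A, measurable A -> nu A = \int[mu]_(x in A) (g x)%:E.

Import HBNNSimple.

Let integral_density_nnsfun (f : {nnsfun T >-> R}) :
  \int[nu]_x (f x)%:E = \int[mu]_x ((f x)%:E * (g x)%:E).
Proof.
under [LHS]eq_integral do rewrite fimfunE -fsumEFin//.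
rewrite [LHS]ge0_integral_fsum//; last 2 first.
  - by move=> r; exact/measurable_EFinP/measurableT_comp.
  - by move=> n x _; rewrite EFinM nnfun_muleindic_ge0.
under [RHS]eq_integral.
  move=> x xD; rewrite fimfunE -fsumEFin// muleC ge0_mule_fsumr; last first.
    by move=> r; rewrite EFinM nnfun_muleindic_ge0.
  over.
rewrite [RHS]ge0_integral_fsum//; last 2 first.
  - move=> r; apply: emeasurable_funM; first exact/measurable_EFinP.
    exact/measurable_EFinP/measurableT_comp.
  - move=> n x _; apply: mule_ge0; first by rewrite lee_fin.
    by rewrite EFinM nnfun_muleindic_ge0.
apply: eq_fsbigr => r _; rewrite integralZl_indic_nnsfun//= integral_indic// setIT.
(* The simple function is nonnegative, so its level set at a negative value is empty; for [r] at
   least 0 the constant can be moved out of a nonnegative integral. *)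
have [r0|r0] := ltP r 0%R.
  rewrite [X in nu X](_ : _ = set0); last by rewrite preimage_nnfun0.
  rewrite measure0 mule0 integral0_eq// => x _.
  by rewrite [X in \1_X](_ : _ = set0) ?preimage_nnfun0// indic0 mulr0 mule0.
rewrite nuE// integral_mkcond/= -ge0_integralZl//.
- apply: eq_integral => x _; rewrite patchE indicE.
  case: ifPn => xA; first by rewrite mulr1 muleC.
  by rewrite mulr0 !mule0.
- apply/(measurable_restrictT _ _).1 => //; apply: measurable_funTS.
  exact/measurable_EFinP.
- by move=> x _; rewrite patchE; case: ifPn => // _; rewrite lee_fin.
Qed.

(** Monotone convergence from the simple functions, on both sides. *)
Lemma ge0_integral_density (f : T -> \bar R) :
  measurable_fun setT f -> (forall x, 0 <= f x) ->
  \int[nu]_x f x = \int[mu]_x (f x * (g x)%:E).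
Proof.
move=> mf f0.
pose f_ := nnsfun_approx measurableT mf.
transitivity (limn (fun n => \int[nu]_x (f_ n x)%:E)).
  rewrite -monotone_convergence//=.
  - apply: eq_integral => ? /[!inE] xD; apply/esym/cvg_lim => //=.
    exact: cvg_nnsfun_approx.
  - by move=> n; exact/measurable_EFinP/measurable_funTS.
  - by move=> n ? _; rewrite lee_fin.
  - by move=> ? _ ? ? mn; rewrite lee_fin; exact/lefP/nd_nnsfun_approx.
rewrite (_ : (fun n => _) = fun n => \int[mu]_x ((f_ n x)%:E * (g x)%:E)); last first.
  by apply/funext => n; exact: integral_density_nnsfun.
rewrite -monotone_convergence//=.
- apply: eq_integral => x _; apply/cvg_lim => //=.
  apply: cvgeZr => //; exact: cvg_nnsfun_approx.
- move=> n; apply: emeasurable_funM; last exact/measurable_EFinP.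
  exact/measurable_EFinP/measurable_funTS.
- by move=> n x _; rewrite mule_ge0 ?lee_fin.
- move=> x _ m n mn; rewrite lee_wpmul2r ?lee_fin//.
  exact/lefP/nd_nnsfun_approx.
Qed.

End integral_density.

Lemma ge0_integral_normal (R : realType) (m : R) (f : R -> \bar R) :
  measurable_fun setT f -> (forall x, 0 <= f x)%E ->
  (\int[normal_prob m 1]_x f x =
   \int[lebesgue_measure]_x (f x * (normal_pdf m 1 x)%:E))%E.
Proof.
move=> mf f0; apply: ge0_integral_density => //.
- exact: measurable_normal_pdf.
- by move=> x; exact: normal_pdf_ge0.
Qed.

(** Overwriting coordinate [i] in place lets a one-dimensional identity be used under an integral
    over [mvnormal] without permuting coordinates. *)
Definition tset (R : realType) (p : nat) (i : 'I_p) (t : R) (y : vec R p) :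
  vec R p := [tuple if j == i then t else tnth y j | j < p].

Lemma tnth_tset (R : realType) (p : nat) (i j : 'I_p) (t : R) (y : vec R p) :
  tnth (tset i t y) j = if j == i then t else tnth y j.
Proof. by rewrite tnth_mktuple. Qed.

Lemma tset_cons0 (R : realType) (p : nat) (t u : R) (y : vec R p) :
  tset ord0 t (vcons (u, y)) = vcons (t, y).
Proof.
apply/eq_from_tnth => j; rewrite tnth_tset.
by case: (unliftP ord0 j) => [k ->|->]; rewrite ?tnthS ?tnth0.
Qed.

Lemma tset_consS (R : realType) (p : nat) (i : 'I_p) (t u : R) (y : vec R p) :
  tset (lift ord0 i) t (vcons (u, y)) = vcons (u, tset i t y).
Proof.
apply/eq_from_tnth => j; rewrite tnth_tset.
case: (unliftP ord0 j) => [k ->|->]; last by rewrite !tnth0.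
by rewrite !tnthS tnth_tset (inj_eq lift_inj).
Qed.

Lemma measurable_tnth_comp d (T : measurableType d) (R : realType) (p : nat)
    (j : 'I_p) (g : T -> vec R p) : measurable_fun setT g ->
  measurable_fun setT (fun z => tnth (g z) j : measurableTypeR R).
Proof. by move=> mg; exact: (measurable_fun_tnthP g).1 mg j. Qed.

Lemma measurable_tset d (T : measurableType d) (R : realType) (p : nat) (i : 'I_p)
    (g : T -> measurableTypeR R) (h : T -> vec R p) :
  measurable_fun setT g -> measurable_fun setT h ->
  measurable_fun setT (fun z => tset i (g z) (h z)).
Proof.
move=> mg mh; apply/measurable_fun_tnthP => j.
rewrite (_ : _ \o _ = fun z => if j == i then g z else tnth (h z) j); last first.
  by apply/funext => z /=; rewrite tnth_tset.
by case: (j == i) => //; exact: measurable_tnth_comp.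
Qed.

Lemma measurable_vcons_comp d (T : measurableType d) (R : realType) (p : nat)
    (g : T -> measurableTypeR R) (h : T -> vec R p) :
  measurable_fun setT g -> measurable_fun setT h ->
  measurable_fun setT (fun z => vcons (g z, h z)).
Proof. exact: measurable_cons. Qed.

Section mvnormal_integral.
Local Open Scope ereal_scope.
Variable R : realType.

Lemma integral_mvnormalS (p : nat) (b : vec R p.+1) (f : vec R p.+1 -> \bar R) :
  measurable_fun setT f -> (forall y, 0 <= f y) ->
  \int[mvnormal b]_y f y =
  \int[normal_prob (thead b) 1]_t \int[mvnormal [tuple of behead b]]_y f (vcons (t, y)).
Proof.
move=> mf f0 /=.
rewrite ge0_integral_pushforward//= preimage_setT.
rewrite fubini_tonelli1//=.
exact: (measurableT_comp mf (@measurable_vcons R p)).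
Qed.

Local Opaque mvnormal.

(* Resampling one coordinate from its own law does not change the expectation. *)
Lemma integral_mvnormal_tset (p : nat) (b : vec R p) (i : 'I_p) (f : vec R p -> \bar R) :
  measurable_fun setT f -> (forall y, 0 <= f y) ->
  \int[mvnormal b]_y f y =
  \int[mvnormal b]_y \int[normal_prob (tnth b i) 1]_t f (tset i t y).
Proof.
elim: p b i f => [b [] //|p ih b i f mf f0].
have mtf j : measurable_fun setT (fun y : vec R p.+1 =>
    \int[normal_prob (tnth b j) 1]_t f (tset j t y)).
  apply: (@measurable_fun_fubini_tonelli_F _ _ _ _ _
    (normal_prob (tnth b j) 1) (fun z => f (tset j z.2 z.1))) => //=.
  apply: (measurableT_comp mf).
  exact: measurable_tset.
have mc t : measurable_fun setT (fun y : vec R p => f (vcons (t, y))).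
  by apply: (measurableT_comp mf); exact: measurable_vcons_comp.
rewrite [RHS]integral_mvnormalS//; last first.
  by move=> y; apply: integral_ge0.
case: (unliftP ord0 i) => [j ->|->].
  rewrite [LHS](integral_mvnormalS b mf f0); apply: eq_integral => u _.
  rewrite [LHS](ih [tuple of behead b] j _ (mc u) (fun y => f0 _)); apply: eq_integral => y _.
  rewrite (_ : tnth _ j = tnth b (lift ord0 j)); last first.
    by case/tupleP: b {mtf} => x t; rewrite tnthS; congr tnth; apply/val_inj.
  by apply: eq_integral => t _; rewrite tset_consS.
rewrite [LHS](integral_mvnormalS b mf f0).
(* After overwriting the first coordinate the integrand no longer depends on its old value, so the
   outer integral is that of a constant against a probability; only the order of integration remains
   to be exchanged. *)
under [RHS]eq_integral do under eq_integral do under eq_integral do rewrite tset_cons0.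
rewrite integral_cst//= probability_setT mule1.
rewrite -[LHS](@fubini_tonelli2 _ _ _ _ _ _ _ (fun z => f (vcons (z.2, z.1))))//=; last first.
  apply: (measurableT_comp mf).
  exact: measurable_vcons_comp.
rewrite fubini_tonelli1//=; last first.
  apply: (measurableT_comp mf).
  exact: measurable_vcons_comp.
Qed.

End mvnormal_integral.

(** * Total derivatives with vanishing integral *)

Section pointwise_derivatives.
Variable R : realType.
Implicit Types (f g : R -> R) (x a b c : R).

Lemma derD f g x a b : is_derive x 1 f a -> is_derive x 1 g b ->
  is_derive x 1 (fun t => f t + g t) (a + b).
Proof. exact: is_deriveD. Qed.

Lemma derB f g x a b : is_derive x 1 f a -> is_derive x 1 g b ->
  is_derive x 1 (fun t => f t - g t) (a - b).
Proof. exact: is_deriveB. Qed.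

Lemma derM f g x a b : is_derive x 1 f a -> is_derive x 1 g b ->
  is_derive x 1 (fun t => f t * g t) (f x * b + g x * a).
Proof. exact: is_deriveM. Qed.

Lemma der_eq f x a b : is_derive x 1 f a -> a = b -> is_derive x 1 f b.
Proof. by move=> + <-. Qed.

Lemma der_cst c x : is_derive x 1 (fun _ : R => c) 0.
Proof. exact: is_derive_cst. Qed.

Lemma der_id x : is_derive x 1 (fun t : R => t) 1.
Proof. exact: is_derive_id. Qed.

Lemma der_sqr x : is_derive x 1 (fun t : R => t ^+ 2) (2 * x).
Proof.
apply: (@der_eq _ _ (x * 1 + x * 1)); ring.
Qed.

Lemma der_comp f g x a b : is_derive (g x) 1 f a -> is_derive x 1 g b ->
  is_derive x 1 (fun t => f (g t)) (a * b).
Proof. exact: is_derive1_comp. Qed.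

Lemma der_exp g x a : is_derive x 1 g a ->
  is_derive x 1 (fun t => expR (g t)) (expR (g x) * a).
Proof. by apply: der_comp; exact: is_derive_expR. Qed.

Lemma der_continuous f x a : is_derive x 1 f a -> {for x, continuous f}.
Proof. by move=> [fx _]; apply/differentiable_continuous/derivable1_diffP. Qed.

End pointwise_derivatives.

Section exhaustion.
Variable R : realType.
Notation mu := (@lebesgue_measure R).

(** On [[a n, b n]] the integral is [F (b n) - F (a n)], which tends to [l - l]; dominated
    convergence, with the absolute value of [f] as majorant, passes to [D]. It serves for the whole
    line and for []0, 1[], where [F] need not be differentiable at the ends. *)
Lemma integral_derive_zero (D : set R) (F f : R -> R) (a b : nat -> R) (l : R) :
  measurable D -> (forall n, a n < b n) ->
  (forall n, `[a n, b n] `<=` D) ->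
  (forall x, D x -> \forall n \near \oo, `[a n, b n]%classic x) ->
  (forall x, D x -> is_derive x 1 F (f x)) ->
  (forall x, D x -> {for x, continuous f}) ->
  mu.-integrable D (EFin \o f) ->
  F (a n) @[n --> \oo] --> l -> F (b n) @[n --> \oo] --> l ->
  (\int[mu]_(x in D) (f x)%:E = 0)%E.
Proof.
move=> mD ab abD Dab dF cf fi Fa Fb.
pose f_ n := (EFin \o f) \_ `[a n, b n].
have f_E n : (\int[mu]_(x in D) f_ n x = (F (b n) - F (a n))%:E)%E.
  rewrite -integral_mkcondr setIidr// EFinB.
  apply: continuous_FTC2 => //.
  - by apply: continuous_in_subspaceT => x /[!inE] /abD/cf.
  - split.
    + by move=> x /subset_itv_oo_cc/abD/dF[].
    + apply: cvg_at_right_filter; apply: (der_continuous (dF _ (abD n _ _))).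
      by rewrite /= in_itv/= lexx ltW.
    + apply: cvg_at_left_filter; apply: (der_continuous (dF _ (abD n _ _))).
      by rewrite /= in_itv/= lexx ltW.
  - by move=> x /subset_itv_oo_cc/abD/dF[_ <-]; rewrite derive1E.
have mf : measurable_fun D (EFin \o f) by case/integrableP : fi.
have [|||||_ _] := @dominated_convergence _ _ _ mu D mD f_ (EFin \o f)
    (abse \o (EFin \o f)).
- move=> n; apply: (measurable_restrict (EFin \o f) _ mD).1 => //.
  by apply: measurable_funS mf => //; exact: subIsetl.
- exact: mf.
- apply: aeW => x Dx; apply: cvg_near_cst.
  have := Dab x Dx; apply: filterS => n abx.
  by rewrite /f_ patchE mem_set.
- exact: integrable_abse.
- apply: aeW => x n Dx; rewrite /f_ patchE; case: ifPn => // _.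
  by rewrite abse0 abse_ge0.
have fE : (fun n => \int[mu]_(x in D) f_ n x)%E = EFin \o (fun n => F (b n) - F (a n)).
  by apply/funext => n; rewrite f_E.
rewrite fE => cv1.
have cv2 : (EFin \o (fun n => F (b n) - F (a n))) @ \oo --> 0%:E.
  apply: cvg_EFin; first exact: nearW.
  by rewrite -(subrr l); exact: cvgB.
by apply: (cvg_unique _ cv1 cv2).
Qed.

End exhaustion.

(** * Total derivatives dominated by a Gaussian *)

Section gaussian_decay.
Variable R : realType.
Notation mu := (@lebesgue_measure R).
Implicit Types (k m x C : R).

(** Unnormalized normal density, parametrized by the precision [k]: posterior precisions are then
    simply [1 + tau ^+ 2], and halving [k] absorbs polynomial factors. *)
Definition gauss_kernel k m x : R := expR (- (k / 2 * (x - m) ^+ 2)).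

Lemma continuous_gauss_kernel k m : continuous (gauss_kernel k m).
Proof.
move=> x; apply: continuous_comp; last exact: continuous_expR.
apply: continuousN; apply: continuousM; first exact: cst_continuous.
apply: (@continuous_comp _ _ _ (fun x : R => x - m) (fun u => u ^+ 2)).
  by apply: continuousB; [exact: cvg_id|exact: cst_continuous].
exact: exprn_continuous.
Qed.

Lemma derive_gauss_kernel k m x :
  is_derive x 1 (gauss_kernel k m) (gauss_kernel k m x * (- (k * (x - m)))).
Proof.
apply: der_exp.
have d1 : is_derive x 1 (fun t : R => t - m) (1 - 0).
  exact: (derB (der_id x) (der_cst m x)).
have d2 := @der_comp _ (fun u => u ^+ 2) (fun t => t - m) x _ _ (der_sqr (x - m)) d1.
have d3 := derM (der_cst (k / 2) x) d2.
have := derM (der_cst (-1) x) d3.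
rewrite (_ : (fun t => -1 * _) = fun t => - (k / 2 * (t - m) ^+ 2)); last first.
  by apply/funext => t; rewrite mulN1r.
by move/der_eq; apply; field.
Qed.

Lemma integrable_gauss_kernel k m : 0 < k ->
  mu.-integrable setT (EFin \o gauss_kernel k m).
Proof.
move=> k0.
have s0 : (Num.sqrt k)^-1 != 0 by rewrite invr_eq0 gt_eqF// sqrtr_gt0.
have -> : EFin \o gauss_kernel k m = (fun x : R => ((normal_peak (Num.sqrt k)^-1)^-1)%:E *
    (normal_pdf m (Num.sqrt k)^-1 x)%:E)%E.
  apply/funext => x; rewrite normal_pdfE//= -EFinM mulKf ?gt_eqF ?normal_peak_gt0//.
  rewrite /gauss_kernel /normal_fun exprVn sqr_sqrtr ?ltW//.
  congr (expR _)%:E; rewrite -mulr_natr; field.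
  by rewrite gt_eqF.
apply: integrableZl => //; exact: integrable_normal_pdf.
Qed.

(** The kernel of precision [k] is the square of [g], the kernel of precision [k / 2]. One factor
    [g] absorbs the polynomial: [g <= 1], and [1 + k u / 4 <= g^-1] gives [u * g <= 4 / k]. *)
Lemma gauss_kernel_moment k m x : 0 < k ->
  (1 + (x - m) ^+ 2) * gauss_kernel k m x <=
  (1 + 4 / k) * gauss_kernel (k / 2) m x.
Proof.
move=> k0; set u := (x - m) ^+ 2.
have u0 : 0 <= u by exact: sqr_ge0.
have -> : gauss_kernel k m x = gauss_kernel (k / 2) m x * gauss_kernel (k / 2) m x.
  by rewrite /gauss_kernel -expRD -/u; congr expR; field.
set g := gauss_kernel _ _ _.
have g0 : 0 < g by exact: expR_gt0.
have g1 : g <= 1.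
  rewrite /g /gauss_kernel -[leRHS]expR0 ler_expR -/u oppr_le0.
  by rewrite mulr_ge0// divr_ge0// divr_ge0// ltW.
have gu : u * g <= 4 / k.
  have : 1 + k / 2 / 2 * u <= g^-1.
    by rewrite /g /gauss_kernel -expRN opprK -/u expR_ge1Dx.
  rewrite -(ler_pM2r g0) mulVf ?gt_eqF// => h.
  rewrite ler_pdivlMr//.
  have e : (1 + k / 2 / 2 * u) * g = g + u * g * k / 4 by field.
  by move: h; rewrite e; lra.
rewrite mulrA ler_pM2r// mulrDl mul1r.
by apply: lerD.
Qed.

Lemma integrable_gauss_dominated k m C (f : R -> R) : 0 < k ->
  measurable_fun setT f ->
  (forall x, `|f x| <= C * ((1 + (x - m) ^+ 2) * gauss_kernel k m x)) ->
  mu.-integrable setT (EFin \o f).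
Proof.
move=> k0 mf fC.
have k20 : 0 < k / 2 by rewrite divr_gt0.
have C0 : 0 <= C.
  have := le_trans (normr_ge0 _) (fC m).
  by rewrite subrr expr0n/= addr0 mul1r pmulr_lge0// expR_gt0.
have gi : mu.-integrable setT
    (fun x => (C * (1 + 4 / k))%:E * (gauss_kernel (k / 2) m x)%:E)%E.
  by apply: integrableZl => //; exact: integrable_gauss_kernel.
apply: le_integrable gi => //; first exact/measurable_EFinP.
move=> x _; rewrite -EFinM /= lee_fin.
rewrite [leRHS]ger0_norm; last first.
  rewrite mulr_ge0 ?expR_ge0//; apply: mulr_ge0 => //.
  by rewrite addr_ge0// divr_ge0// ltW.
by rewrite -mulrA (le_trans (fC x))// ler_wpM2l// gauss_kernel_moment.
Qed.

(** The bound on [f] gives integrability and the bound on [F] gives limit 0 at both ends, so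
    [integral_derive_zero] applies along the intervals of radius [n.+1] around [m]. *)
Lemma integral_gauss_derive k m C (F f : R -> R) : 0 < k ->
  (forall x, is_derive x 1 F (f x)) -> continuous f ->
  (forall x, `|F x| <= C * ((1 + (x - m) ^+ 2) * gauss_kernel k m x)) ->
  (forall x, `|f x| <= C * ((1 + (x - m) ^+ 2) * gauss_kernel k m x)) ->
  mu.-integrable setT (EFin \o f) /\ (\int[mu]_x (f x)%:E = 0)%E.
Proof.
move=> k0 dF cf FC fC.
have fi : mu.-integrable setT (EFin \o f).
  apply: (integrable_gauss_dominated k0 _ fC).
  exact: continuous_measurable_fun.
split => //.
have C0 : 0 <= C.
  have := le_trans (normr_ge0 _) (fC m).
  by rewrite subrr expr0n/= addr0 mul1r pmulr_lge0// expR_gt0.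
(* The factor [1 + 4 / k] comes from [gauss_kernel_moment]; the last [4 / k] bounds [|x - m|] times
   the remaining kernel when [|x - m|] is at least 1. The resulting decay in [1 / |x - m|] is enough
   for comparison with the harmonic sequence. *)
pose K := C * (1 + 4 / k) * (4 / k).
have k4 : 0 <= 4 / k by rewrite divr_ge0// ltW.
have K0 : 0 <= K.
  by apply: mulr_ge0 => //; apply: mulr_ge0 => //; rewrite addr_ge0.
have dec x : 1 <= `|x - m| -> `|F x| <= K * `|x - m|^-1.
  move=> x1; have x0 : 0 < `|x - m| by exact: lt_le_trans x1.
  rewrite (le_trans (FC x))//.
  rewrite (@le_trans _ _ (C * ((1 + 4 / k) * gauss_kernel (k / 2) m x)))//.
    by rewrite ler_wpM2l// gauss_kernel_moment.
  rewrite /K -[leRHS]mulrA -[leRHS]mulrA; apply: ler_wpM2l => //.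
  apply: ler_wpM2l; first by rewrite addr_ge0.
  have : 1 + k / 2 / 2 * `|x - m| ^+ 2 <= (gauss_kernel (k / 2) m x)^-1.
    by rewrite /gauss_kernel -expRN opprK real_normK ?num_real// expR_ge1Dx.
  set g := gauss_kernel _ _ _.
  have g0 : 0 < g by exact: expR_gt0.
  move=> /(ler_wpM2r (ltW g0)); rewrite mulVf ?gt_eqF// => h.
  rewrite ler_pdivlMr// ler_pdivlMr//.
  have e : (1 + k / 2 / 2 * `|x - m| ^+ 2) * g =
     g + g * `|x - m| * k / 4 * `|x - m| by field.
  rewrite e in h.
  have : g * `|x - m| * k / 4 <= g * `|x - m| * k / 4 * `|x - m|.
    by rewrite ler_peMr// !mulr_ge0// ltW.
  by lra.
have harm : (K * n.+1%:R^-1) @[n --> \oo] --> (0 : R).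
  rewrite -[X in _ --> X](mulr0 K).
  by apply: cvgM; [exact: cvg_cst|exact: cvg_harmonic].
have sq (u : nat -> R) : (forall n, `|u n| <= K * n.+1%:R^-1) ->
    u n @[n --> \oo] --> (0 : R).
  move=> uK; apply: (@squeeze_cvgr _ _ _ _ (fun n => - (K * n.+1%:R^-1))
    (fun n => K * n.+1%:R^-1)) => //.
    by apply: nearW => n; rewrite -ler_norml.
  by rewrite -oppr0; apply: cvgN.
apply: (@integral_derive_zero _ setT F f (fun n => m - n.+1%:R)
    (fun n => m + n.+1%:R) 0) => //.
- by move=> n; rewrite ltrD2l (@lt_trans _ _ 0)// oppr_lt0.
- move=> x _; exists (Num.truncn `|x - m|).+1 => // n /= xn.
  rewrite in_itv/= -ler_distlC distrC.
  rewrite ltW//; apply: (lt_le_trans (truncnS_gt _)).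
  by rewrite ler_nat (leq_trans xn).
- by move=> x _; exact: cf.
- apply: (sq (fun n => F (m - n.+1%:R))) => n; rewrite (le_trans (dec _ _))//.
    by rewrite addrAC subrr add0r normrN normr_nat ler1n.
  by rewrite addrAC subrr add0r normrN normr_nat.
- apply: (sq (fun n => F (m + n.+1%:R))) => n; rewrite (le_trans (dec _ _))//.
    by rewrite addrAC subrr add0r normr_nat ler1n.
  by rewrite addrAC subrr add0r normr_nat.
Qed.

End gaussian_decay.

(** * The Bayes lower bound on the supremum of the risk *)

Section posterior_variance.
Variable R : realType.
Notation mu := (@lebesgue_measure R).

Lemma normal_pdf_kernel (m x : R) :
  normal_pdf m 1 x = normal_peak 1 * gauss_kernel 1 m x.
Proof.
rewrite normal_pdfE ?oner_eq0// /normal_fun /gauss_kernel.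
by congr (_ * expR _); rewrite expr1n; field.
Qed.

(** Completing the square in [s]: likelihood times prior is a normal kernel with posterior precision
    [1 + tau ^+ 2] and posterior mean [tau * t / (1 + tau ^+ 2)]. *)
Lemma gauss_kernel_posterior (C t tau s : R) :
  expR (C + tau * s * t - tau ^+ 2 * s ^+ 2 / 2) * normal_pdf 0 1 s =
  normal_peak 1 * expR (C + (tau * t) ^+ 2 / (2 * (1 + tau ^+ 2))) *
    gauss_kernel (1 + tau ^+ 2) (tau * t / (1 + tau ^+ 2)) s.
Proof.
have k0 : 1 + tau ^+ 2 != 0 by rewrite gt_eqF// ltr_pwDl// sqr_ge0.
rewrite normal_pdf_kernel mulrCA -[RHS]mulrA; congr (_ * _).
by rewrite /gauss_kernel -!expRD; congr expR; field.
Qed.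

(** Mean squared error is variance plus squared bias, and the posterior variance of [tau * s] is
    [tau ^+ 2 / (1 + tau ^+ 2)], whatever the estimate [D] and the observation [t]. *)
Lemma posterior_risk_ge (D C t tau : R) :
  ((tau ^+ 2 / (1 + tau ^+ 2))%:E *
   \int[normal_prob 0 1]_s (expR (C + tau * s * t - tau ^+ 2 * s ^+ 2 / 2))%:E <=
   \int[normal_prob 0 1]_s
     ((D - tau * s) ^+ 2 * expR (C + tau * s * t - tau ^+ 2 * s ^+ 2 / 2))%:E)%E.
Proof.
set k := 1 + tau ^+ 2; set m := tau * t / k.
have k0 : 0 < k by rewrite ltr_pwDl// sqr_ge0.
have me : measurable_fun setT
    (fun s : R => expR (C + tau * s * t - tau ^+ 2 * s ^+ 2 / 2)).
  apply: measurableT_comp => //; apply: measurable_funB.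
    by apply: measurable_funD => //; apply: measurable_funM => //; apply: measurable_funM.
  by apply: measurable_funM => //; apply: measurable_funM => //; exact: measurable_funX.
rewrite ge0_integral_normal; [|exact/measurable_EFinP|by move=> s; rewrite lee_fin expR_ge0].
rewrite ge0_integral_normal; first last.
- by move=> s; rewrite lee_fin mulr_ge0 ?sqr_ge0 ?expR_ge0.
- apply/measurable_EFinP; apply: measurable_funM => //.
  by apply: measurable_funX; apply: measurable_funB => //; exact: measurable_funM.
set P := normal_peak 1 * expR (C + (tau * t) ^+ 2 / (2 * k)).
have P0 : 0 <= P by rewrite mulr_ge0 ?normal_peak_ge0 ?expR_ge0.
pose G := gauss_kernel k m.
have G0 s : 0 <= G s by exact: expR_ge0.
(* [(D - tau s)^2 - tau^2 / k] times [G] is [D'^2 G] plus the derivative of [F]. *)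
pose D' := D - tau * m.
pose f s := (- tau ^+ 2 / k - 2 * tau * D' * (s - m) + tau ^+ 2 * (s - m) ^+ 2) * G s.
pose F s := (2 * tau * D' / k - tau ^+ 2 / k * (s - m)) * G s.
pose K := `|tau ^+ 2 / k| + `|2 * tau * D'| + `|tau ^+ 2| + `|2 * tau * D' / k|.
have u_le (u : R) : `|u| <= 1 + u ^+ 2.
  rewrite -[u ^+ 2]real_normK ?num_real//; set v := `|u|.
  have := sqr_ge0 (v - 1 / 2); have -> : (v - 1 / 2) ^+ 2 = v ^+ 2 - v + 1 / 4 by field.
  by lra.
have Gf : mu.-integrable setT (EFin \o f) /\ (\int[mu]_x (f x)%:E = 0)%E.
  apply: (@integral_gauss_derive _ k m K F f k0).
  - move=> s.
    have d1 : is_derive s 1 (fun s : R => s - m) (1 - 0).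
      exact: (derB (der_id s) (der_cst m s)).
    have d2 := derM (der_cst (tau ^+ 2 / k) s) d1.
    have d3 := derB (der_cst (2 * tau * D' / k) s) d2.
    have := derM d3 (derive_gauss_kernel k m s).
    by move/der_eq; apply; rewrite /f /G; field; rewrite gt_eqF.
  - have cu : continuous (fun s : R => s - m).
      by move=> s; exact: (der_continuous (derB (der_id s) (der_cst m s))).
    have cq : continuous (fun s : R =>
        - tau ^+ 2 / k - 2 * tau * D' * (s - m) + tau ^+ 2 * (s - m) ^+ 2).
      move=> s; apply: cvgD.
        apply: cvgB; first exact: cvg_cst.
        by apply: cvgM; [exact: cvg_cst|exact: cu].
      apply: cvgM; first exact: cvg_cst.
      exact: (continuous_comp (cu s) (@exprn_continuous _ 2 _)).
    move=> s; rewrite /f; apply: cvgM; first exact: cq.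
    exact: continuous_gauss_kernel.
  - move=> s; rewrite /F normrM (ger0_norm (G0 s)) mulrA ler_wpM2r//.
    rewrite (le_trans (ler_normB _ _))// [`|tau ^+ 2 / k * _|]normrM.
    rewrite (@le_trans _ _ (`|2 * tau * D' / k| * (1 + (s - m) ^+ 2) +
       `|tau ^+ 2 / k| * (1 + (s - m) ^+ 2)))//.
      apply: lerD; last by rewrite ler_wpM2l.
      by rewrite ler_peMr// lerDl sqr_ge0.
    rewrite -mulrDl ler_wpM2r//; first by rewrite addr_ge0// sqr_ge0.
    rewrite /K; have := normr_ge0 (2 * tau * D'); have := normr_ge0 (tau ^+ 2).
    by lra.
  - move=> s; rewrite /f normrM (ger0_norm (G0 s)) mulrA ler_wpM2r//.
    rewrite (le_trans (ler_normD _ _))//.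
    rewrite (@le_trans _ _ ((`|tau ^+ 2 / k| * (1 + (s - m) ^+ 2) +
       `|2 * tau * D'| * (1 + (s - m) ^+ 2)) + `|tau ^+ 2| * (1 + (s - m) ^+ 2)))//.
      rewrite lerD//.
        rewrite (le_trans (ler_normB _ _))// mulNr normrN; apply: lerD.
          by rewrite ler_peMr// lerDl sqr_ge0.
        by rewrite [`|_ * (s - m)|]normrM ler_wpM2l.
      by rewrite normrM (ger0_norm (sqr_ge0 (s - m))) ler_wpM2l// lerDr.
    rewrite -!mulrDl ler_wpM2r//; first by rewrite addr_ge0// sqr_ge0.
    by rewrite /K lerDl.
have {Gf} [fi f0] := Gf.
(* Variance part plus squared bias part. Adding [P * f s], which integrates to 0, recovers the
   actual loss; dropping the bias part gives the lower bound. *)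
pose h s := P * (tau ^+ 2 / k) * G s + P * D' ^+ 2 * G s.
have Gi := integrable_gauss_kernel m k0.
have hi : mu.-integrable setT (EFin \o h).
  rewrite (_ : EFin \o h = (fun s => (P * (tau ^+ 2 / k))%:E * (EFin \o G) s +
    (P * D' ^+ 2)%:E * (EFin \o G) s)%E)//.
  by apply: integrableD => //; apply: integrableZl.
rewrite -ge0_integralZl//; last 3 first.
- apply: emeasurable_funM; apply/measurable_EFinP => //.
  exact: measurable_normal_pdf.
- by move=> s _; rewrite mule_ge0// lee_fin ?expR_ge0// normal_pdf_ge0.
- by rewrite lee_fin divr_ge0// ?sqr_ge0// ltW.
apply: (@le_trans _ _ (\int[mu]_s (h s)%:E)%E).
  apply: ge0_le_integral => //=.
  - move=> s _; rewrite -!EFinM lee_fin; apply: mulr_ge0.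
      by rewrite divr_ge0 ?sqr_ge0// ltW.
    by rewrite mulr_ge0 ?expR_ge0 ?normal_pdf_ge0.
  - apply: measurable_funeM; apply: emeasurable_funM; apply/measurable_EFinP => //.
    exact: measurable_normal_pdf.
  - by case/integrableP : hi.
  - move=> s _; rewrite -!EFinM lee_fin gauss_kernel_posterior -/k -/m -/P -/(G s).
    rewrite /h mulrCA mulrA lerDl.
    by rewrite mulr_ge0// mulr_ge0// sqr_ge0.
have <- : (\int[mu]_s ((h s)%:E + P%:E * (f s)%:E) = \int[mu]_s (h s)%:E)%E.
  rewrite integralD//; last by apply: integrableZl.
  by rewrite integralZl// f0 mule0 adde0.
rewrite le_eqVlt; apply/orP; left; apply/eqP; apply: eq_integral => s _.
rewrite -!EFinM -EFinD -[in RHS](mulrA ((D - _) ^+ 2)) gauss_kernel_posterior -/k -/m -/P -/(G s).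
congr EFin; rewrite /h /f /D'; field.
by rewrite gt_eqF.
Qed.

End posterior_variance.

(** * Change of measure to the centred normal law *)

Section likelihood.
Local Open Scope ereal_scope.
Variable R : realType.
Local Opaque mvnormal normal_prob.

Definition vzero (p : nat) : vec R p := [tuple 0%R | i < p].

(* The density of [mvnormal b] with respect to [mvnormal (vzero p)]. *)
Definition lik (p : nat) (b y : vec R p) : R :=
  expR (\sum_(i < p) (tnth b i * tnth y i - tnth b i ^+ 2 / 2)).

Lemma integral_normal_lik (m : R) (f : R -> \bar R) :
  measurable_fun setT f -> (forall t, 0 <= f t) ->
  \int[normal_prob m 1]_t f t =
  \int[normal_prob 0 1]_t (f t * (expR (m * t - m ^+ 2 / 2))%:E).
Proof.
move=> mf f0.
have mg : measurable_fun setT (fun t => f t * (expR (m * t - m ^+ 2 / 2))%:E).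
  apply: emeasurable_funM => //; apply/measurable_EFinP; apply: measurableT_comp => //.
  by apply: measurable_funB => //; exact: measurable_funM.
have g0 t : 0 <= f t * (expR (m * t - m ^+ 2 / 2))%:E.
  by rewrite mule_ge0// lee_fin expR_ge0.
rewrite [LHS](ge0_integral_normal m mf f0) [RHS](ge0_integral_normal 0 mg g0).
apply: eq_integral => t _; rewrite -muleA -EFinM; congr (_ * _%:E).
rewrite !normal_pdf_kernel mulrCA; congr (_ * _)%R.
by rewrite /gauss_kernel -expRD; congr expR; field.
Qed.

Lemma measurable_lik d (T : measurableType d) (p : nat) (b y : T -> vec R p) :
  measurable_fun setT b -> measurable_fun setT y ->
  measurable_fun setT (fun z => lik (b z) (y z)).
Proof.
move=> mb my; apply: measurableT_comp => //.
apply: measurable_sum => i; apply: measurable_funB.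
  by apply: measurable_funM; exact: measurable_tnth_comp.
by apply: measurable_funM => //; apply: measurable_funX; exact: measurable_tnth_comp.
Qed.

Lemma lik_ge0 (p : nat) (b y : vec R p) : (0 <= lik b y)%R.
Proof. exact: expR_ge0. Qed.

Lemma behead_vzero (p : nat) : [tuple of behead (vzero p.+1)] = vzero p.
Proof.
apply/eq_from_tnth => i; rewrite tnth_mktuple.
by rewrite tnth_behead tnth_mktuple.
Qed.

Lemma lik_cons (p : nat) (b : vec R p.+1) (t : R) (y : vec R p) :
  lik b (vcons (t, y)) =
  (expR (thead b * t - thead b ^+ 2 / 2) * lik [tuple of behead b] y)%R.
Proof.
rewrite /lik big_ord_recl expRD tnth0; congr (_ * expR _)%R.
apply: eq_bigr => i _; rewrite !tnth_behead tnthS.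
rewrite (_ : inord i.+1 = lift ord0 i)//.
by apply/val_inj; rewrite /= inordK// ltnS ltn_ord.
Qed.

(** With a reference law independent of [b], the parameter occurs only in the integrand, so Tonelli
    can exchange the parameter with the observation. The density splits off one coordinate at a
    time. *)
Lemma integral_mvnormal_lik (p : nat) (b : vec R p) (f : vec R p -> \bar R) :
  measurable_fun setT f -> (forall y, 0 <= f y) ->
  \int[mvnormal b]_y f y = \int[mvnormal (vzero p)]_y (f y * (lik b y)%:E).
Proof.
elim: p b f => [b f mf f0|p ih b f mf f0].
  rewrite (tuple0 b) (tuple0 (vzero 0)); apply: eq_integral => y _.
  by rewrite /lik big_ord0 expR0 mule1.
have ml : measurable_fun setT (fun y => f y * (lik b y)%:E).
  apply: emeasurable_funM => //; apply/measurable_EFinP.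
  by apply: measurable_lik => //; exact: measurable_cst.
have fl0 y : 0 <= f y * (lik b y)%:E by rewrite mule_ge0// lee_fin lik_ge0.
rewrite [LHS](integral_mvnormalS b mf f0) [RHS](integral_mvnormalS (vzero p.+1) ml fl0).
have mc t : measurable_fun setT (fun y : vec R p => f (vcons (t, y))).
  by apply: (measurableT_comp mf); exact: measurable_vcons_comp.
have mfl : measurable_fun setT (fun z : measurableTypeR R * vec R p =>
    f (vcons (z.1, z.2)) * (lik [tuple of behead b] z.2)%:E).
  apply: emeasurable_funM.
    by apply: (measurableT_comp mf); exact: measurable_vcons_comp.
  by apply/measurable_EFinP; apply: measurable_lik => //; exact: measurable_cst.
have mI : measurable_fun setT (fun t : measurableTypeR R => \int[mvnormal (vzero p)]_y
    (f (vcons (t, y)) * (lik [tuple of behead b] y)%:E)).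
  have fl0' z : 0 <= f (vcons (z.1, z.2)) * (lik [tuple of behead b] z.2)%:E.
    by rewrite mule_ge0// lee_fin lik_ge0.
  exact: (@measurable_fun_fubini_tonelli_F _ _ _ _ _ (mvnormal (vzero p)) _ mfl fl0').
have hb0 : thead (vzero p.+1) = 0%R by rewrite /thead tnth_mktuple.
rewrite behead_vzero hb0.
have I0 t : 0 <= \int[mvnormal (vzero p)]_y
    (f (vcons (t, y)) * (lik [tuple of behead b] y)%:E).
  by apply: integral_ge0 => y _; rewrite mule_ge0// lee_fin lik_ge0.
transitivity (\int[normal_prob (thead b) 1]_t \int[mvnormal (vzero p)]_y
    (f (vcons (t, y)) * (lik [tuple of behead b] y)%:E)).
  by apply: eq_integral => t _; exact: (ih [tuple of behead b] _ (mc t) (fun y => f0 _)).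
rewrite [LHS](integral_normal_lik (thead b) mI I0).
apply: eq_integral => t _.
rewrite -[LHS]ge0_integralZr//.
- apply: eq_integral => y _.
  by rewrite lik_cons EFinM [X in _ = _ * X]muleC muleA.
- apply: emeasurable_funM; first exact: mc.
  by apply/measurable_EFinP; apply: measurable_lik => //; exact: measurable_cst.
- by move=> y _; rewrite mule_ge0// lee_fin lik_ge0.
Qed.

End likelihood.

(** * Averaging the risk over a normal prior *)

Section minimax_lower_bound.
Local Open Scope ereal_scope.
Variable R : realType.
Local Opaque mvnormal normal_prob.

Lemma integral_lik (p : nat) (b : vec R p) :
  \int[mvnormal (vzero R p)]_y (lik b y)%:E = 1.
Proof.
have := @integral_mvnormal_lik _ p b (cst 1) (measurable_cst _) (fun _ => lee01).
rewrite integral_cst//= mul1e probability_setT => ->.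
by apply: eq_integral => y _; rewrite mul1e.
Qed.

Lemma measurable_vscale d (T : measurableType d) (p : nat) (c : T -> R) (y : T -> vec R p) :
  measurable_fun setT c -> measurable_fun setT y ->
  measurable_fun setT (fun z => vscale (c z) (y z)).
Proof.
move=> mc my; apply/measurable_fun_tnthP => i.
rewrite (_ : _ \o _ = fun z => c z * tnth (y z) i)%R; last first.
  by apply/funext => z /=; rewrite tnth_mktuple.
by apply: measurable_funM => //; exact: measurable_tnth_comp.
Qed.

(** The other coordinates contribute only an additive constant to the exponent; this is the shape in
    which [posterior_risk_ge] takes the likelihood. *)
Lemma lik_tset (p : nat) (i : 'I_p) (tau : R) (z y : vec R p) :
  exists C, forall s, lik (vscale tau (tset i s z)) y =
    expR (C + tau * s * tnth y i - tau ^+ 2 * s ^+ 2 / 2).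
Proof.
exists (\sum_(j < p | j != i)
  (tau * tnth z j * tnth y j - (tau * tnth z j) ^+ 2 / 2))%R => s.
rewrite /lik (bigD1 i)//=; congr expR.
rewrite !tnth_mktuple eqxx exprMn [LHS]addrC addrA; congr (_ + _ - _)%R.
by apply: eq_bigr => j ji; rewrite !tnth_mktuple (negbTE ji).
Qed.

(* For fixed [y] the integral over [z] is, up to a factor, a posterior expected
   square loss; only the coordinate [z_i] has to be integrated to bound it. *)
Lemma average_coordinate_risk_ge (p : nat) (tau : R) (i : 'I_p) (g : vec R p -> R) :
  measurable_fun setT g ->
  ((tau ^+ 2 / (1 + tau ^+ 2))%:E <=
   \int[mvnormal (vzero R p)]_z \int[mvnormal (vzero R p)]_y
     ((g y - tau * tnth z i) ^+ 2 * lik (vscale tau z) y)%:E).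
Proof.
move=> mg; set nu := mvnormal (vzero R p); set c : R := (_ / _)%R.
have nuT : nu setT = 1 by exact: probability_setT.
have c0 : (0 <= c)%R by rewrite divr_ge0 ?sqr_ge0// addr_ge0// sqr_ge0.
have mL : measurable_fun setT (fun w : vec R p * vec R p =>
    (lik (vscale tau w.1) w.2)%:E).
  apply/measurable_EFinP; apply: measurable_lik => //.
  exact: measurable_vscale.
have mG : measurable_fun setT (fun w : vec R p * vec R p =>
    ((g w.2 - tau * tnth w.1 i) ^+ 2 * lik (vscale tau w.1) w.2)%:E).
  apply/measurable_EFinP; apply: measurable_funM; last exact/measurable_EFinP.
  apply: measurable_funX; apply: measurable_funB.
    exact: measurableT_comp.
  by apply: measurable_funM => //; exact: measurable_tnth_comp.
have G0 w : 0 <= ((g w.2 - tau * tnth w.1 i) ^+ 2 * lik (vscale tau w.1) w.2)%:E.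
  by rewrite lee_fin mulr_ge0 ?sqr_ge0 ?lik_ge0.
have L0 (w : vec R p * vec R p) : 0 <= (lik (vscale tau w.1) w.2)%:E.
  by rewrite lee_fin lik_ge0.
rewrite (@fubini_tonelli _ _ _ _ _ nu nu _ mG G0)/=.
(* The inner integral is the marginal density of the observation, of total mass 1. Spreading [c]
   over it reduces the claim to a comparison for each fixed [y]. *)
have -> : c%:E = \int[nu]_y (c%:E * \int[nu]_z (lik (vscale tau z) y)%:E).
  rewrite ge0_integralZl//.
  - rewrite -(@fubini_tonelli _ _ _ _ _ nu nu _ mL L0)/=.
    under eq_integral do rewrite integral_lik.
    by rewrite integral_cst// mul1e -[LHS]mule1; congr (_ * _); exact/esym/nuT.
  - exact: (@measurable_fun_fubini_tonelli_G _ _ _ _ _ nu _ mL L0).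
  - by move=> y _; apply: integral_ge0 => z _; rewrite lee_fin lik_ge0.
apply: ge0_le_integral => //.
- move=> y _; rewrite mule_ge0//; apply: integral_ge0 => z _.
  by rewrite lee_fin lik_ge0.
- apply: measurable_funeM.
  exact: (@measurable_fun_fubini_tonelli_G _ _ _ _ _ nu _ mL L0).
- exact: (@measurable_fun_fubini_tonelli_G _ _ _ _ _ nu _ mG G0).
move=> y _.
have mLy : measurable_fun setT (fun z : vec R p => (lik (vscale tau z) y)%:E).
  apply/measurable_EFinP; apply: measurable_lik; last exact: measurable_cst.
  exact: measurable_vscale.
have mGy : measurable_fun setT (fun z : vec R p =>
    ((g y - tau * tnth z i) ^+ 2 * lik (vscale tau z) y)%:E).
  apply/measurable_EFinP; apply: measurable_funM; last exact/measurable_EFinP.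
  apply: measurable_funX; apply: measurable_funB => //.
  by apply: measurable_funM => //; exact: measurable_tnth_comp.
have mT (f : vec R p -> \bar R) : measurable_fun setT f -> (forall x, 0 <= f x) ->
   measurable_fun setT (fun z => \int[normal_prob 0 1]_s f (tset i s z)).
  move=> mf f0; apply: (@measurable_fun_fubini_tonelli_F _ _ _ _ _
    (normal_prob 0 1) (fun w => f (tset i w.2 w.1))) => //=.
  by apply: (measurableT_comp mf); exact: measurable_tset.
(* Resampling coordinate [i] on both sides leaves a comparison of integrals over that coordinate
   alone. *)
rewrite (@integral_mvnormal_tset _ _ (vzero R p) i _ mLy (fun z => L0 (z, y))).
rewrite (@integral_mvnormal_tset _ _ (vzero R p) i _ mGy (fun z => G0 (z, y))).
have -> : tnth (vzero R p) i = 0%R by rewrite tnth_mktuple.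
rewrite -ge0_integralZl//; last 2 first.
- by apply: mT mLy _ => z; exact: (L0 (z, y)).
- by move=> z _; apply: integral_ge0 => s _; exact: (L0 (_, y)).
apply: ge0_le_integral => //.
- by move=> z _; rewrite mule_ge0//; apply: integral_ge0 => s _; exact: (L0 (_, y)).
- by apply: measurable_funeM; apply: mT mLy _ => z; exact: (L0 (z, y)).
- by apply: mT mGy _ => z; exact: (G0 (z, y)).
move=> z _; have [C CE] := lik_tset i tau z y.
under eq_integral do rewrite CE.
under [X in _ <= X]eq_integral do rewrite CE tnth_tset eqxx.
exact: posterior_risk_ge.
Qed.

Lemma sup_risk_ge (p : nat) (delta : vec R p -> vec R p) :
  measurable_fun setT delta -> p%:R%:E <= sup_risk delta.
Proof.
move=> md; set nu := mvnormal (vzero R p).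
have nuT : nu setT = 1 by exact: probability_setT.
have mS : measurable_fun setT (fun w : vec R p * vec R p =>
    (sqnorm (vsub (delta w.2) w.1))%:E).
  apply/measurable_EFinP; apply: measurable_sum => i; apply: measurable_funX.
  rewrite (_ : (fun w => _) = fun w => tnth (delta w.2) i - tnth w.1 i)%R; last first.
    by apply/funext => w; rewrite tnth_mktuple.
  apply: measurable_funB; last exact: measurable_tnth_comp.
  by apply: measurable_tnth_comp; exact: measurableT_comp.
have S0 (x : vec R p) : 0 <= (sqnorm x)%:E.
  by rewrite lee_fin; apply: sumr_ge0 => i _; exact: sqr_ge0.
have key (tau : R) : (p%:R * (tau ^+ 2 / (1 + tau ^+ 2)))%:E <= sup_risk delta.
  set c : R := (tau ^+ 2 / _)%R.
  have riskE z : risk delta (vscale tau z) = \int[nu]_y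
      \sum_(i < p) ((tnth (delta y) i - tau * tnth z i) ^+ 2 * lik (vscale tau z) y)%:E.
    rewrite /risk integral_mvnormal_lik//; last first.
      apply: (measurableT_comp mS (g := fun y => (vscale tau z, y))) => //.
      exact: measurable_fun_pair.
    apply: eq_integral => y _; rewrite -EFinM sumEFin -mulr_suml; congr ((_ * _)%:E).
    by apply: eq_bigr => i _; rewrite !tnth_mktuple.
  have mi i : measurable_fun setT (fun w : vec R p * vec R p =>
      ((tnth (delta w.2) i - tau * tnth w.1 i) ^+ 2 * lik (vscale tau w.1) w.2)%:E).
    apply/measurable_EFinP; apply: measurable_funM; last first.
      by apply: measurable_lik => //; exact: measurable_vscale.
    apply: measurable_funX; apply: measurable_funB.
      by apply: measurable_tnth_comp; exact: measurableT_comp.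
    by apply: measurable_funM => //; exact: measurable_tnth_comp.
  have i0 i (w : vec R p * vec R p) : 0 <=
      ((tnth (delta w.2) i - tau * tnth w.1 i) ^+ 2 * lik (vscale tau w.1) w.2)%:E.
    by rewrite lee_fin mulr_ge0 ?sqr_ge0 ?lik_ge0.
  have mF i : measurable_fun setT (fun z => \int[nu]_y
      ((tnth (delta y) i - tau * tnth z i) ^+ 2 * lik (vscale tau z) y)%:E).
    exact: (@measurable_fun_fubini_tonelli_F _ _ _ _ _ nu _ (mi i) (i0 i)).
  have rE z : risk delta (vscale tau z) = \sum_(i < p) \int[nu]_y
      ((tnth (delta y) i - tau * tnth z i) ^+ 2 * lik (vscale tau z) y)%:E.
    rewrite riskE ge0_integral_sum// => i.
      apply: (measurableT_comp (mi i) (g := fun y => (z, y))).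
      exact: measurable_fun_pair.
    by move=> y _; exact: (i0 i (z, y)).
  have r0 z : 0 <= risk delta (vscale tau z).
    by apply: integral_ge0 => y _; exact: S0.
  (* The average risk for the parameter [tau * z], with [z] standard normal, lies between the two
     sides. *)
  apply: (@le_trans _ _ (\int[nu]_z risk delta (vscale tau z))).
    under eq_integral do rewrite rE.
    rewrite ge0_integral_sum//; last first.
      by move=> i z _; apply: integral_ge0 => y _; exact: (i0 i (z, y)).
    rewrite mulr_natl -[X in (X *+ _)%R]/c.
    apply: (@le_trans _ _ (\sum_(i < p) c%:E)).
      by rewrite sumEFin sumr_const card_ord.
    apply: lee_sum => i _; apply: average_coordinate_risk_ge.
    exact: measurable_tnth_comp.
  apply: (@le_trans _ _ (\int[nu]_z cst (sup_risk delta) z)).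
    apply: ge0_le_integral => //.
    - rewrite (_ : (fun z => _) = fun z => \sum_(i < p) \int[nu]_y
          ((tnth (delta y) i - tau * tnth z i) ^+ 2 * lik (vscale tau z) y)%:E).
        by apply: emeasurable_sum => i; exact: mF.
      by apply/funext => z; rewrite rE.
    - by move=> z _; apply: ereal_sup_ubound; exists (vscale tau z).
  by rewrite integral_cst// -[leRHS]mule1 -nuT.
apply/lee_addgt0Pr => e e0.
case: (sup_risk delta) key => [r| |] key; last 2 first.
- by rewrite addye ?leey.
- by have := key 0%R; rewrite leeNy_eq.
rewrite -EFinD lee_fin.
(* A prior variance chosen so that [p = e * (tau2 - 1)]; then [p * tau2 - (p - e) * (1 + tau2)] is
   exactly [2 * e]. *)
pose tau2 : R := (p%:R / e + 1)%R.
have tp : (0 < tau2)%R by rewrite ltr_pwDr// divr_ge0// ltW.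
have := key (Num.sqrt tau2); rewrite lee_fin (sqr_sqrtr (ltW tp)) => h.
rewrite -lerBlDr; apply: le_trans h.
have d0 : (0 < 1 + tau2)%R by rewrite addr_gt0.
rewrite mulrA ler_pdivlMr//.
have pe : (p%:R = e * (tau2 - 1))%R by rewrite /tau2 addrK mulrCA divff ?mulr1// gt_eqF.
rewrite -subr_ge0 pe.
rewrite (_ : _ - _ = 2 * e)%R; last by ring.
by rewrite mulr_ge0// ltW.
Qed.

End minimax_lower_bound.

(** * Stein's unbiased risk estimate *)

Section unbiased_risk_estimate.
Variable R : realType.
Variables (phi phi' : R -> R) (M : R).
Hypothesis dphi : forall w : R, is_derive w 1 phi (phi' w).
Hypothesis cphi' : continuous phi'.
Hypothesis phi01 : forall w : R, 0 <= w -> 0 <= phi w <= 1.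
Hypothesis phiM : forall w : R, 0 <= w -> w * phi w <= M.
Hypothesis phi'_le : forall w : R, 0 <= w -> `|phi' w| <= phi w.

Notation mu := (@lebesgue_measure R).

Let cphi : continuous phi.
Proof. by move=> w; exact: der_continuous (dphi w). Qed.

Let M0 : 0 <= M.
Proof. by have := phiM (lexx 0); rewrite mul0r. Qed.

(** The terms of [unbiased_coord] are at most 1, 2, [4 * M] and [M] in absolute value: since
    [t ^+ 2 <= w], both [t ^+ 2 * phi' w] and [t ^+ 2 * phi w ^+ 2] are controlled by
    [w * phi w <= M]. *)
Let K := 3 + 5 * M.

Let K0 : 0 <= K.
Proof. by rewrite /K addr_ge0// mulr_ge0. Qed.

Definition loss_coord (m t w : R) := ((1 - phi w) * t - m) ^+ 2.

(** One coordinate of Stein's unbiased risk estimate. In the expanded loss, [(t - m) ^+ 2] is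
    replaced by 1 and [(t - m) * t * phi] by the derivative [phi + 2 * t ^+ 2 * phi'] of [t * phi],
    as [w] has derivative [2 * t] in [t]. *)
Definition unbiased_coord (t w : R) :=
  1 - 2 * phi w - 4 * t ^+ 2 * phi' w + t ^+ 2 * phi w ^+ 2.

Let tphi' (t w : R) : t ^+ 2 <= w -> `|t ^+ 2 * phi' w| <= M.
Proof.
move=> tw; have w0 : 0 <= w by rewrite (le_trans _ tw)// sqr_ge0.
rewrite normrM (ger0_norm (sqr_ge0 t)) (le_trans _ (phiM w0))//.
by apply: ler_pM => //; [exact: sqr_ge0|exact: phi'_le].
Qed.

Let tphi (t w : R) : t ^+ 2 <= w -> 0 <= t ^+ 2 * phi w ^+ 2 <= M.
Proof.
move=> tw; have w0 : 0 <= w by rewrite (le_trans _ tw)// sqr_ge0.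
rewrite mulr_ge0 ?sqr_ge0//=.
rewrite (le_trans _ (phiM w0))//; apply: ler_pM => //; rewrite ?sqr_ge0//.
by case/andP: (phi01 w0) => p0 p1; rewrite expr2 ler_piMr.
Qed.

Lemma unbiased_coord_bound (t w : R) : t ^+ 2 <= w -> `|unbiased_coord t w| <= K.
Proof.
move=> tw; have w0 : 0 <= w by rewrite (le_trans _ tw)// sqr_ge0.
have /andP[p0 p1] := phi01 w0; have /andP[q0 q1] := tphi tw.
have := tphi' tw; rewrite !ler_norml => /andP[r0 r1].
rewrite /unbiased_coord /K -mulrA; apply/andP; split; lra.
Qed.

(* The constant [K] keeps both integrands nonnegative, so that only Tonelli's
   theorem is needed in several dimensions. *)
Lemma stein_coord (m c : R) : 0 <= c ->
  (\int[normal_prob m 1]_t (loss_coord m t (t ^+ 2 + c) + K)%:E =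
   \int[normal_prob m 1]_t (unbiased_coord t (t ^+ 2 + c) + K)%:E)%E.
Proof.
move=> c0; pose w (t : R) := t ^+ 2 + c.
have tw (t : R) : t ^+ 2 <= w t by rewrite lerDl.
have w0 (t : R) : 0 <= w t by rewrite addr_ge0// sqr_ge0.
have dw (t : R) : is_derive t 1 w (2 * t).
  by have := derD (der_sqr t) (der_cst c t); rewrite addr0.
have cw : continuous w by move=> t; exact: der_continuous (dw t).
have dpw (t : R) : is_derive t 1 (fun t => phi (w t)) (phi' (w t) * (2 * t)).
  exact: (@der_comp _ phi w t _ _ (dphi (w t)) (dw t)).
have cpw : continuous (fun t => phi (w t)).
  by move=> t; exact: der_continuous (dpw t).
have cp'w : continuous (fun t => phi' (w t)).
  by move=> t; exact: (continuous_comp (cw t) (@cphi' _)).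
have cid : continuous (fun t : R => t) by move=> t; exact: der_continuous (der_id t).
have csq : continuous (fun t : R => t ^+ 2) by move=> t; exact: der_continuous (der_sqr t).
pose l t := loss_coord m t (w t); pose h t := unbiased_coord t (w t).
have cl : continuous l.
  move=> t; apply: (@continuous_comp _ _ _ (fun t => (1 - phi (w t)) * t - m)
    (fun u => u ^+ 2)); last exact: csq.
  apply: cvgB; last exact: cvg_cst.
  apply: cvgM; last exact: cid.
  by apply: cvgB; [exact: cvg_cst|exact: cpw].
have ch : continuous h.
  move=> t; apply: cvgD.
    apply: cvgB.
      apply: cvgB; first exact: cvg_cst.
      by apply: cvgM; [exact: cvg_cst|exact: cpw].
    apply: cvgM; last exact: cp'w.
    by apply: cvgM; [exact: cvg_cst|exact: csq].
  apply: cvgM; first exact: csq.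
  exact: (continuous_comp (cpw t) (csq _)).
pose G := gauss_kernel 1 m.
have G0 t : 0 <= G t by exact: expR_ge0.
pose f t := (l t - h t) * G t.
(* An antiderivative of [f]: the first term encodes Stein's identity for [t * phi], the second the
   unit variance of [t]. *)
pose F t := (2 * (t * phi (w t)) - (t - m)) * G t.
have u_le (u : R) : `|u| <= 1 + u ^+ 2.
  rewrite -[u ^+ 2]real_normK ?num_real//; set v := `|u|.
  have := sqr_ge0 (v - 1 / 2); have -> : (v - 1 / 2) ^+ 2 = v ^+ 2 - v + 1 / 4 by field.
  by lra.
have tphi_le t : `|t * phi (w t)| <= 1 + M.
  rewrite (le_trans (u_le _))// lerD2l exprMn.
  by have /andP[] := tphi (tw t).
have [fi f0] : mu.-integrable setT (EFin \o f) /\ (\int[mu]_x (f x)%:E = 0)%E.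
  apply: (@integral_gauss_derive _ 1 m (6 + 6 * M) F f) => //.
  - move=> t.
    have d1 := derM (der_id t) (dpw t).
    have d2 := derM (der_cst 2 t) d1.
    have d3 := derB d2 (derB (der_id t) (der_cst m t)).
    have := derM d3 (derive_gauss_kernel 1 m t).
    move/der_eq; apply; rewrite /f /G /l /h /loss_coord /unbiased_coord; ring.
  - move=> t; apply: cvgM; last exact: continuous_gauss_kernel.
    by apply: cvgB; [exact: cl|exact: ch].
  - move=> t; rewrite /F normrM (ger0_norm (G0 t)) [leRHS]mulrA ler_wpM2r//.
    rewrite (le_trans (ler_normB _ _))// normrM (@ger0_norm _ 2)//.
    have := tphi_le t; have := u_le (t - m); have := sqr_ge0 (t - m); have := M0.
    set a := `|t * _|; set b := `|t - m|; set q := (t - m) ^+ 2 => m0 q0 bq am.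
    have mq : 0 <= M * q by rewrite mulr_ge0.
    by rewrite mulrDl !mulrDr !mulr1; lra.
  - move=> t; rewrite /f normrM (ger0_norm (G0 t)) [leRHS]mulrA ler_wpM2r//.
    have -> : l t - h t = (t - m) ^+ 2 - 1 - 2 * ((t - m) * (t * phi (w t))) +
        2 * phi (w t) + 4 * (t ^+ 2 * phi' (w t)).
      by rewrite /l /h /loss_coord /unbiased_coord; ring.
    have pr : `|(t - m) * (t * phi (w t))| <= (1 + (t - m) ^+ 2) * (1 + M).
      by rewrite normrM ler_pM.
    have /andP[p0 p1] := phi01 (w0 t).
    have := tphi' (tw t); have := sqr_ge0 (t - m); have := M0; move: pr p0 p1.
    rewrite !ler_norml; set a := (t - m) * _; set b := _ * phi' _.
    set q := (t - m) ^+ 2; set e := phi _.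
    move=> /andP[a0 a1] e0 e1 m0 q0 /andP[b0 b1].
    have mq : 0 <= M * q by rewrite mulr_ge0.
    move: a0 a1; rewrite !mulrDl !mulrDr !mul1r !mulr1 [q * M]mulrC => a0 a1.
    by apply/andP; split; lra.
have hK t : 0 <= h t + K <= K + K.
  have := unbiased_coord_bound (tw t); rewrite ler_norml -/(h t) => /andP[h0 h1].
  by apply/andP; split; lra.
have lK t : 0 <= l t + K by rewrite addr_ge0// sqr_ge0.
have mh : measurable_fun setT (fun t => (h t + K)%:E).
  apply/measurable_EFinP; apply: measurable_funD => //.
  exact: continuous_measurable_fun.
have ml : measurable_fun setT (fun t => (l t + K)%:E).
  apply/measurable_EFinP; apply: measurable_funD => //.
  exact: continuous_measurable_fun.
have l0' t : (0 <= (l t + K)%:E)%E by rewrite lee_fin.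
have h0' t : (0 <= (h t + K)%:E)%E by rewrite lee_fin; case/andP: (hK t).
rewrite [LHS](ge0_integral_normal m ml l0') [RHS](ge0_integral_normal m mh h0').
pose P : R := normal_peak 1.
have hi : mu.-integrable setT (fun t => (h t + K)%:E * (normal_pdf m 1 t)%:E)%E.
  have gi : mu.-integrable setT (fun t => (K + K)%:E * (normal_pdf m 1 t)%:E)%E.
    by apply: integrableZl => //; exact: integrable_normal_pdf.
  apply: le_integrable gi => //.
    by apply: emeasurable_funM => //; apply/measurable_EFinP; exact: measurable_normal_pdf.
  move=> t _; rewrite -!EFinM lee_fin !normrM ler_wpM2r//.
  have /andP[a b] := hK t.
  by rewrite !ger0_norm// addr_ge0.
(* Both summands are known to be integrable, so the integral splits without any prior knowledge that
   the loss is. *)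
transitivity (\int[mu]_t ((h t + K)%:E * (normal_pdf m 1 t)%:E + P%:E * (f t)%:E))%E.
  apply: eq_integral => t _; rewrite -!EFinM -EFinD; congr EFin.
  by rewrite normal_pdf_kernel /f -/P -/(G t); ring.
rewrite integralD//; last by apply: integrableZl.
by rewrite integralZl// f0 mule0 adde0.
Qed.

Let sqnorm_tset (p : nat) (i : 'I_p) (t : R) (y : vec R p) :
  sqnorm (tset i t y) = t ^+ 2 + \sum_(j < p | j != i) tnth y j ^+ 2.
Proof.
rewrite /sqnorm (bigD1 i)//= tnth_tset eqxx; congr (_ + _).
by apply: eq_bigr => j ji; rewrite tnth_tset (negbTE ji).
Qed.

Let mphi : measurable_fun setT phi.
Proof. exact: continuous_measurable_fun. Qed.

Let mphi' : measurable_fun setT phi'.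
Proof. exact: continuous_measurable_fun. Qed.

Lemma measurable_sqnorm (p : nat) : measurable_fun setT (@sqnorm R p).
Proof.
apply: measurable_sum => i; apply: measurable_funX.
by apply: measurable_tnth_comp; exact: measurable_id.
Qed.

Local Opaque mvnormal normal_prob.

(** Summed over the coordinates, [unbiased_coord] is p plus the expression assumed nonpositive. Each
    coordinate's loss is exchanged for its unbiased estimate by freezing the others, whose squares
    form the constant [c] of [stein_coord]. *)
Lemma shrinkage_risk_le (p : nat) (b : vec R p) :
  (forall w, 0 <= w -> - 2 * p%:R * phi w - 4 * w * phi' w + w * phi w ^+ 2 <= 0) ->
  (risk (fun y : vec R p => vscale (1 - phi (sqnorm y)) y) b <= p%:R%:E)%E.
Proof.
move=> sup; set nu := mvnormal b.
have nuT : nu setT = 1%E by exact: probability_setT.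
pose l (i : 'I_p) y := loss_coord (tnth b i) (tnth y i) (sqnorm y) + K.
pose h (i : 'I_p) y := unbiased_coord (tnth y i) (sqnorm y) + K.
have sq0 (y : vec R p) : 0 <= sqnorm y by apply: sumr_ge0 => i _; exact: sqr_ge0.
have ysq (y : vec R p) i : tnth y i ^+ 2 <= sqnorm y.
  rewrite /sqnorm (bigD1 i)//= lerDl.
  by apply: sumr_ge0 => j _; exact: sqr_ge0.
have l0 i y : (0 <= (l i y)%:E)%E by rewrite lee_fin addr_ge0// sqr_ge0.
have h0 i y : (0 <= (h i y)%:E)%E.
  have := unbiased_coord_bound (ysq y i); rewrite ler_norml => /andP[a _].
  by rewrite lee_fin /h; lra.
have mt i : measurable_fun setT (fun y : vec R p => tnth y i : R).
  by apply: measurable_tnth_comp; exact: measurable_id.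
have ms := @measurable_sqnorm p.
have mp : measurable_fun setT (fun y : vec R p => phi (sqnorm y)).
  exact: measurableT_comp.
have mp' : measurable_fun setT (fun y : vec R p => phi' (sqnorm y)).
  exact: measurableT_comp.
have ml i : measurable_fun setT (fun y => (l i y)%:E).
  apply/measurable_EFinP; apply: measurable_funD => //.
  apply: measurable_funX; apply: measurable_funB => //.
  by apply: measurable_funM; [exact: measurable_funB|exact: mt].
have mh i : measurable_fun setT (fun y => (h i y)%:E).
  apply/measurable_EFinP; apply: measurable_funD => //.
  apply: measurable_funD; last first.
    by apply: measurable_funM; apply: measurable_funX => //; exact: mt.
  apply: measurable_funB.
    by apply: measurable_funB => //; apply: measurable_funM.
  apply: measurable_funM => //; apply: measurable_funM => //.
  by apply: measurable_funX; exact: mt.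
have lh i : (\int[nu]_y (l i y)%:E = \int[nu]_y (h i y)%:E)%E.
  rewrite [LHS](@integral_mvnormal_tset _ _ b i _ (ml i) (l0 i)).
  rewrite [RHS](@integral_mvnormal_tset _ _ b i _ (mh i) (h0 i)).
  apply: eq_integral => y _.
  have c0 : 0 <= \sum_(j < p | j != i) tnth y j ^+ 2.
    by apply: sumr_ge0 => j _; exact: sqr_ge0.
  have := stein_coord (tnth b i) c0.
  rewrite /l /h; move=> e.
  under eq_integral do rewrite tnth_tset eqxx sqnorm_tset.
  by rewrite e; apply: eq_integral => t _; rewrite tnth_tset eqxx sqnorm_tset.
have S0 y : (0 <= (sqnorm (vsub (vscale (1 - phi (sqnorm y)) y) b))%:E)%E.
  by rewrite lee_fin.
have SE y : (\sum_(i < p) (l i y)%:E =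
    (sqnorm (vsub (vscale (1 - phi (sqnorm y)) y) b))%:E + (K *+ p)%:E)%E.
  rewrite sumEFin /l big_split/= sumr_const card_ord EFinD; congr (_%:E + _)%E.
  by apply: eq_bigr => i _; rewrite !tnth_mktuple.
have hE y : (\sum_(i < p) (h i y)%:E <= (p%:R + K *+ p)%:E)%E.
  rewrite sumEFin /h big_split/= sumr_const card_ord lee_fin lerD2r.
  rewrite /unbiased_coord big_split/= !sumrB !sumr_const card_ord.
  rewrite -!mulr_suml -mulr_sumr -/(sqnorm y).
  have := sup _ (sq0 y).
  set a := phi _; set a' := phi' _; set s := sqnorm y => sup0.
  rewrite -subr_le0; apply: le_trans sup0.
  by rewrite le_eqVlt; apply/orP; left; apply/eqP; ring.
have mS : measurable_fun setT
    (fun y : vec R p => (sqnorm (vsub (vscale (1 - phi (sqnorm y)) y) b))%:E).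
  have -> : (fun y : vec R p => (sqnorm (vsub (vscale (1 - phi (sqnorm y)) y) b))%:E) =
      (fun y => (\sum_(i < p) (l i y)%:E - (K *+ p)%:E)%E).
    by apply/funext => y; rewrite SE addeK.
  apply: emeasurable_funB; first exact: emeasurable_sum.
  exact: measurable_cst.
have Kp : (0 <= (K *+ p)%:E)%E by rewrite lee_fin mulrn_wge0.
(* The p copies of [K] form a finite amount, so they can be added on both sides even while the risk
   might still be infinite. *)
rewrite -(@leeD2rE _ (K *+ p)%:E)//.
have <- : (\int[nu]_y \sum_(i < p) (l i y)%:E =
    risk (fun y : vec R p => vscale (1 - phi (sqnorm y)) y) b + (K *+ p)%:E)%E.
  under eq_integral do rewrite SE.
  rewrite ge0_integralD// integral_cst//; congr (_ + _)%E.
  by rewrite -[RHS]mule1; congr (_ * _)%E; exact: nuT.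
rewrite ge0_integral_sum//.
under eq_bigr do rewrite lh.
rewrite -ge0_integral_sum//.
apply: (@le_trans _ _ (\int[nu]_y (p%:R + K *+ p)%:E)%E).
  apply: ge0_le_integral => //; first by move=> y _; apply: sume_ge0.
  exact: emeasurable_sum.
by rewrite integral_cst// -EFinD -[leRHS]mule1 -nuT.
Qed.

End unbiased_risk_estimate.

(** * Laplace transforms of beta densities *)

Section beta_laplace.
Variable R : realType.
Variable be : R.
Hypothesis be01 : 0 < be <= 1.
Notation mu := (@lebesgue_measure R).

Let be0 : 0 < be. Proof. by case/andP: be01. Qed.
Let be1 : be <= 1. Proof. by case/andP: be01. Qed.

Definition beta_kernel (al w k : R) : R :=
  k `^ (al - 1) * (1 - k) `^ (be - 1) * expR (- (k * w / 2)).

(** The integral I_j(w) is [beta_laplace a (A + j) w]. With [al >= 1] and [be <= 1], the kernel can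
    be singular only at 1. *)
Definition beta_laplace (al w : R) : R :=
  \int[mu]_(k in `]0, 1[) beta_kernel al w k.

Let m01 : measurable (`]0, 1[%classic : set R).
Proof. exact: measurable_itv. Qed.

(* [1 - beta_bound n] is the [1 / be]-th power of [1 / (n + 3)], so that
   [(1 - beta_bound n) `^ be] visibly tends to 0. *)
Let beta_bound (n : nat) : R := 1 - (n.+3%:R^-1) `^ be^-1.

Let ivn (n : nat) : 0 < (n.+3%:R^-1 : R) <= 3^-1.
Proof. by rewrite invr_gt0 ltr0n/= lef_pV2 ?posrE// ler_nat. Qed.

Let beta_boundP (n : nat) : 1 - n.+3%:R^-1 <= beta_bound n < 1.
Proof.
have /andP[i0 i1] := ivn n.
rewrite /beta_bound ltrBlDr ltrDl powR_gt0// andbT lerD2l lerN2.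
apply: ge1r_powR; last by rewrite invf_ge1.
by rewrite i0 (le_trans i1)// invf_le1// ler1n.
Qed.

Let beta_bound_powR (n : nat) : (1 - beta_bound n) `^ be = n.+3%:R^-1.
Proof.
have /andP[i0 _] := ivn n.
by rewrite /beta_bound opprB addrCA subrr addr0 -powRrM mulVf ?gt_eqF// powRr1 ?ltW.
Qed.

Let beta_bound_near (k : R) : k < 1 -> \forall n \near \oo, k <= beta_bound n.
Proof.
move=> k1; exists (Num.truncn (1 - k)^-1).+1 => // n /= kn.
have /andP[h _] := beta_boundP n; apply: le_trans h.
rewrite lerBrDr -lerBrDl -[leRHS]invrK lef_pV2 ?posrE//; last by rewrite invr_gt0 subr_gt0.
apply: ltW; apply: (lt_le_trans (truncnS_gt _)).
by rewrite ler_nat (leq_trans kn)// -addn3 leq_addr.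
Qed.

Let der_powR (a x : R) : 0 < x -> is_derive x 1 (fun k => k `^ a) (a * x `^ (a - 1)).
Proof. exact: is_derive1_powR. Qed.

Let der_onem (x : R) : is_derive x 1 (fun k : R => 1 - k) (-1).
Proof. by have := derB (der_cst 1 x) (der_id x); rewrite sub0r. Qed.

Let der_onem_powR (a x : R) : x < 1 ->
  is_derive x 1 (fun k => (1 - k) `^ a) (- (a * (1 - x) `^ (a - 1))).
Proof.
move=> x1; have x0 : 0 < 1 - x by rewrite subr_gt0.
have := @der_comp _ (fun k => k `^ a) (fun k => 1 - k) x _ _ (der_powR a x0) (der_onem x).
by move/der_eq; apply; rewrite mulrN1.
Qed.

Let measurable_onem_powR (a : R) : measurable_fun setT (fun k : R => (1 - k) `^ a).
Proof.
by apply: (measurableT_comp (measurable_powR a)); exact: measurable_funB.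
Qed.

Lemma integrable_onem_powR :
  mu.-integrable `]0, 1[ (fun k => ((1 - k) `^ (be - 1))%:E).
Proof.
pose h (k : R) := (1 - k) `^ (be - 1).
have h0 k : 0 <= h k by exact: powR_ge0.
have mh : measurable_fun setT (EFin \o h).
  by apply/measurable_EFinP; exact: measurable_onem_powR.
pose h_ n := (EFin \o h) \_ `[0, beta_bound n].
have mh_ (n : nat) : measurable_fun (`]0, 1[%classic : set R) (h_ n).
  apply: measurable_funTS; apply/(measurable_restrictT _ _).1 => //.
  exact: measurable_funTS.
have h_0 (n : nat) (k : R) : (`]0, 1[%classic : set R) k -> (0 <= h_ n k)%E.
  by move=> _; rewrite /h_ patchE; case: ifP => // _; rewrite lee_fin.
apply/integrableP; split; first exact: measurable_funTS.
have -> : (\int[mu]_(k in `]0%R, 1%R[) `|((1 - k) `^ (be - 1))%:E| =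
    \int[mu]_(k in `]0%R, 1%R[) (EFin \o h) k)%E.
  by apply: eq_integral => k _; rewrite gee0_abs ?lee_fin ?powR_ge0.
apply: (@le_lt_trans _ _ (be^-1)%:E); last exact: ltry.
have b01 n : 0 < beta_bound n < 1.
  have /andP[a ->] := beta_boundP n; rewrite andbT (lt_le_trans _ a)//.
  have /andP[_ i1] := ivn n; rewrite subr_gt0 (le_lt_trans i1)//.
  by rewrite invf_lt1// ltr1n.
have le_ n : (\int[mu]_(k in `]0%R, 1%R[) h_ n k <= (be^-1)%:E)%E.
  have /andP[bn0 bn1] := b01 n.
  apply: (@le_trans _ _ (\int[mu]_(k in `[0%R, beta_bound n]) (h k)%:E)%E).
    rewrite -integral_mkcondr; apply: ge0_subset_integral => //.
    - exact: measurableI.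
    - exact: measurable_funTS.
    - by move=> k _; rewrite lee_fin.
  have dF (k : R) : k < 1 -> is_derive k 1 (fun k => - be^-1 * (1 - k) `^ be) (h k).
    move=> k1; have := derM (der_cst (- be^-1) k) (der_onem_powR be k1).
    move/der_eq; apply; rewrite mulr0 addr0 mulrNN mulrA mulVf ?mul1r//.
    by rewrite gt_eqF.
  have lt1 (k : R) : k \in `[0, beta_bound n] -> k < 1.
    by rewrite in_itv/= => /andP[_ kn]; exact: le_lt_trans bn1.
  rewrite (@continuous_FTC2 _ h (fun k => - be^-1 * (1 - k) `^ be))//.
  - rewrite -EFinB lee_fin subr0 powR1 mulr1 opprK gerDr mulNr oppr_le0.
    by rewrite mulr_ge0 ?powR_ge0// invr_ge0 ltW.
  - apply: continuous_in_subspaceT => k /[!inE] /lt1 k1.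
    exact: (der_continuous (der_onem_powR _ k1)).
  - split.
    + by move=> k /subset_itv_oo_cc/lt1/dF[].
    + by apply: cvg_at_right_filter; exact: (der_continuous (dF 0 ltr01)).
    + by apply: cvg_at_left_filter; exact: (der_continuous (dF _ bn1)).
  - by move=> k /subset_itv_oo_cc/lt1/dF[_ <-]; rewrite derive1E.
have hl (k : R) : (`]0, 1[%classic : set R) k -> h_ n k @[n --> \oo] --> (h k)%:E.
  rewrite /= in_itv/= => /andP[k0 k1]; apply: cvg_near_cst.
  have := beta_bound_near k1; apply: filterS => n kn.
  by rewrite /h_ patchE mem_set//= in_itv/= kn ltW.
have -> : (\int[mu]_(k in `]0%R, 1%R[) (EFin \o h) k =
    \int[mu]_(k in `]0%R, 1%R[) limn_einf (h_ ^~ k))%E.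
  apply: eq_integral => k /[!inE] /hl kl.
  by have [-> _] := cvg_limn_einf_sup kl.
apply: le_trans (fatou mu m01 mh_ h_0) _.
rewrite limn_einf_lim; apply: lime_le.
  exact: is_cvg_einfs.
apply: nearW => n; apply: le_trans (le_ n).
by apply: ereal_inf_lbound; exists n => /=.
Qed.

(** One majorant for every [al >= 1]. Negative [w] must be covered because differentiating in [w] at
    0 uses a two-sided neighbourhood. *)
Let beta_kernel_bound (al w k : R) : 1 <= al -> 0 < k < 1 ->
  0 <= beta_kernel al w k <= expR (`|w| / 2) * (1 - k) `^ (be - 1).
Proof.
move=> al1 /andP[k0 k1].
rewrite /beta_kernel !mulr_ge0 ?powR_ge0 ?expR_ge0//=.
rewrite mulrC; apply: ler_pM; rewrite ?expR_ge0 ?mulr_ge0 ?powR_ge0//.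
  rewrite ler_expR -mulNr ler_pM2r ?invr_gt0//.
  rewrite (le_trans (ler_norm _))// normrN normrM (ger0_norm (ltW k0)).
  by rewrite ler_piMl// ltW.
rewrite ler_piMl ?powR_ge0//.
rewrite -[leRHS](powRr0 k); apply: ger_powR; first by rewrite k0 ltW.
by rewrite subr_ge0.
Qed.

Let measurable_beta_kernel (al w : R) : measurable_fun setT (beta_kernel al w).
Proof.
apply: measurable_funM.
  by apply: measurable_funM; [exact: measurable_powR|exact: measurable_onem_powR].
apply: measurableT_comp => //; apply: measurableT_comp => //.
by apply: measurable_funM => //; exact: measurable_funM.
Qed.

Lemma integrable_beta_kernel (al w : R) : 1 <= al ->
  mu.-integrable `]0, 1[ (EFin \o beta_kernel al w).
Proof.
move=> al1.
have gi : mu.-integrable `]0, 1[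
    (fun k => (expR (`|w| / 2))%:E * ((1 - k) `^ (be - 1))%:E)%E.
  by apply: integrableZl => //; exact: integrable_onem_powR.
apply: le_integrable gi => //.
  by apply: measurable_funTS; apply/measurable_EFinP; exact: measurable_beta_kernel.
move=> k; rewrite /= in_itv/= => k01.
have /andP[a b] := beta_kernel_bound w al1 k01.
by rewrite lee_fin (ger0_norm a) (ger0_norm (le_trans a b)).
Qed.

Let beta_kernelS (al w k : R) : 0 < k -> 0 < al ->
  beta_kernel (al + 1) w k = k * beta_kernel al w k.
Proof.
move=> k0 al0; rewrite /beta_kernel addrK -(mulr_powRB1 (ltW k0) al0); ring.
Qed.

(** On [[1/4, 1/2]], of length 1/4, the kernel is at least [c]: there [k] is at least 1/4, the power
    of [1 - k] is at least 1 and the exponent is at least [- (|w| / 2)]. *)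
Lemma beta_laplace_gt0 (al w : R) : 1 <= al -> 0 < beta_laplace al w.
Proof.
move=> al1.
have fi := integrable_beta_kernel w al1.
pose c : R := (4^-1) `^ (al - 1) * expR (- (`|w| / 2)).
have c0 : 0 < c by rewrite mulr_gt0 ?expR_gt0// powR_gt0// invr_gt0.
pose I42 : set R := `[4^-1, 2^-1]%classic.
have mI : measurable I42 by exact: measurable_itv.
have muI : mu I42 = (4^-1)%:E.
  rewrite lebesgue_measure_itv/= lte_fin ltf_pV2 ?posrE// ltr_nat/=.
  by rewrite -EFinB; congr (_%:E); field.
have sub : I42 `<=` `]0, 1[%classic.
  move=> k; rewrite /I42 /= !in_itv/= => /andP[k4 k2].
  by rewrite (lt_le_trans _ k4) ?invr_gt0//= (le_lt_trans k2)// invf_lt1// ltr1n.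
have cle : ((c / 4)%:E <= \int[mu]_(k in `]0%R, 1%R[) (beta_kernel al w k)%:E)%E.
  have -> : (c / 4)%:E = (\int[mu]_(k in I42) c%:E)%E.
    by rewrite integral_cst// EFinM; congr (_ * _)%E; exact/esym/muI.
  apply: (@le_trans _ _ (\int[mu]_(k in I42) (beta_kernel al w k)%:E)%E).
    apply: ge0_le_integral => //.
    - by move=> k _; rewrite lee_fin ltW.
    - by apply: measurable_funTS; apply/measurable_EFinP; exact: measurable_beta_kernel.
    - move=> k k42; have := sub _ k42; rewrite /= !in_itv/= => /andP[k0 k1].
      move: k42; rewrite /I42 /= in_itv/= => /andP[k4 k2].
      rewrite lee_fin /c /beta_kernel; apply: ler_pM; rewrite ?powR_ge0 ?expR_ge0//.
        rewrite -[leLHS]mulr1; apply: ler_pM; rewrite ?powR_ge0//.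
          by apply: ge0_ler_powR => //; rewrite ?subr_ge0 ?nnegrE ?invr_ge0// ltW.
        rewrite -[leLHS](powRr0 (1 - k)); apply: ger_powR.
          by rewrite subr_gt0 k1 lerBlDr lerDl ltW.
        by rewrite subr_le0.
      rewrite ler_expR lerN2 ler_pM2r ?invr_gt0//.
      rewrite (le_trans (ler_norm _))// normrM (ger0_norm (ltW k0)).
      by rewrite ler_piMl// ltW.
  apply: ge0_subset_integral => //.
  - by apply: measurable_funTS; apply/measurable_EFinP; exact: measurable_beta_kernel.
  - move=> k; rewrite /= in_itv/= => k01; rewrite lee_fin.
    by have /andP[] := beta_kernel_bound w al1 k01.
rewrite /beta_laplace /Rintegral; apply: (@lt_le_trans _ _ (c / 4)).
  by rewrite divr_gt0.
by rewrite -lee_fin fineK//; exact: integrable_fin_num.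
Qed.

Lemma beta_laplace_leS (al w : R) : 1 <= al ->
  beta_laplace (al + 1) w <= beta_laplace al w.
Proof.
move=> al1; have al0 : 0 < al := lt_le_trans ltr01 al1.
apply: le_Rintegral => //.
- by apply: integrable_beta_kernel; rewrite (le_trans al1)// lerDl.
- exact: integrable_beta_kernel.
- move=> k; rewrite /= in_itv/= => /andP[k0 k1].
  rewrite beta_kernelS// ler_piMl ?(ltW k1)//.
  by rewrite !mulr_ge0 ?powR_ge0 ?expR_ge0.
Qed.

(** Differentiating under the integral brings down the factor [- k / 2], which raises [al] by one;
    on []w - 1, w + 1[] the majorant [G] works because [|x| <= |w| + 1]. *)
Lemma derive_beta_laplace (al w : R) : 1 <= al ->
  is_derive w 1 (beta_laplace al) (- (beta_laplace (al + 1) w / 2)).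
Proof.
move=> al1; have al0 : 0 < al := lt_le_trans ltr01 al1.
have dk (x y : R) : 0 < y -> is_derive x 1 (fun x => beta_kernel al x y)
    (- 2^-1 * beta_kernel (al + 1) x y).
  move=> y0.
  have d1 := derM (der_cst (- (y / 2)) x) (der_id x).
  have d2 := der_exp d1.
  have := derM (der_cst (y `^ (al - 1) * (1 - y) `^ (be - 1)) x) d2.
  rewrite (_ : (fun t => _) = (fun x => beta_kernel al x y)); last first.
    by apply/funext => t; rewrite /beta_kernel; congr (_ * expR _); field.
  move/der_eq; apply; rewrite beta_kernelS// /beta_kernel.
  by rewrite (_ : - (y / 2) * x = - (y * x / 2)); [field|field].
have d1E (x y : R) : 0 < y ->
    partial1of2 (beta_kernel al) x y = - 2^-1 * beta_kernel (al + 1) x y.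
  by move=> y0; rewrite partial1of2E; have [_] := dk x y y0.
pose G (y : R) := expR ((`|w| + 1) / 2) * (1 - y) `^ (be - 1).
have al2 : 1 <= al + 1 by rewrite (le_trans al1)// lerDl.
have wI : (`]w - 1, w + 1[%classic : set R) w.
  by rewrite /= in_itv/= ltrBlDr ltrDl ltr01.
have I1 (x : R) : (`]w - 1, w + 1[%classic : set R) x ->
    mu.-integrable `]0, 1[ (EFin \o beta_kernel al x).
  by move=> _; exact: integrable_beta_kernel.
have I2 (x y : R) : (`]w - 1, w + 1[%classic : set R) x ->
    (`]0, 1[%classic : set R) y -> derivable ((beta_kernel al) ^~ y) x 1.
  by move=> _; rewrite /= in_itv/= => /andP[y0 _]; have [] := dk x y y0.
have I3 (y : R) : 0 <= G y by rewrite mulr_ge0 ?expR_ge0 ?powR_ge0.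
have I4 : mu.-integrable `]0, 1[ (EFin \o G).
  rewrite (_ : _ \o _ = (fun k => (expR ((`|w| + 1) / 2))%:E * ((1 - k) `^ (be - 1))%:E)%E)//.
  by apply: integrableZl => //; exact: integrable_onem_powR.
have I5 (x y : R) : (`]w - 1, w + 1[%classic : set R) x ->
    (`]0, 1[%classic : set R) y -> `|partial1of2 (beta_kernel al) x y| <= G y.
  rewrite /= !in_itv/= => /andP[x0 x1] y01; have /andP[y0 y1] := y01.
  rewrite d1E// normrM normrN.
  have /andP[a b] := beta_kernel_bound x al2 y01.
  rewrite (ger0_norm a) ger0_norm// (@le_trans _ _ (beta_kernel (al + 1) x y))//.
    by rewrite ler_piMl// invf_le1// ler1n.
  rewrite (le_trans b)// /G ler_wpM2r ?powR_ge0//.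
  rewrite ler_expR ler_pM2r ?invr_gt0//.
  rewrite ler_norml; have := ler_norm w; have := ler_norm (- w); rewrite normrN => c d.
  by apply/andP; split; lra.
have dv := @derivable_under_integral R _ _ mu (beta_kernel al) _ m01 w (w - 1) (w + 1) wI I1 I2 G I3 I4 I5.
have := @differentiation_under_integral R _ _ mu (beta_kernel al) _ m01 w (w - 1) (w + 1) wI I1 I2 G I3 I4 I5.
rewrite derive1E => de; apply: (DeriveDef dv); rewrite de.
rewrite (_ : - _ = - 2^-1 * beta_laplace (al + 1) w); last by field.
rewrite -RintegralZl//; last exact: integrable_beta_kernel.
by apply: eq_Rintegral => y /[!inE]/=; rewrite in_itv/= => /andP[y0 _]; rewrite d1E.
Qed.

(** Integration by parts: [F] vanishes at 0 because [al > 0] and at 1 because [be > 0], and [F'] is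
    the kernel times [al * (1 - k) - be * k - w / 2 * k * (1 - k)]. *)
Lemma beta_laplace_recurrence (al w : R) : 1 <= al ->
  w / 2 * (beta_laplace (al + 1) w - beta_laplace (al + 2) w) =
  al * beta_laplace al w - (al + be) * beta_laplace (al + 1) w.
Proof.
move=> al1; have al0 : 0 < al := lt_le_trans ltr01 al1.
pose F (k : R) := k `^ al * ((1 - k) `^ be * expR (- (k * w / 2))).
pose f (k : R) := al * beta_kernel al w k - (al + be) * beta_kernel (al + 1) w k -
  w / 2 * (beta_kernel (al + 1) w k - beta_kernel (al + 1 + 1) w k).
have al20 : 0 < al + 1 by rewrite addr_gt0.
have al2 : 1 <= al + 1 by rewrite (le_trans al1)// lerDl.
have al3 : 1 <= al + 1 + 1 by rewrite (le_trans al2)// lerDl.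
have i1 := integrable_beta_kernel w al1.
have i2 := integrable_beta_kernel w al2.
have i3 := integrable_beta_kernel w al3.
have dF (k : R) : 0 < k < 1 -> is_derive k 1 F (f k).
  move=> /andP[k0 k1].
  have d1 := derM (der_cst (- (w / 2)) k) (der_id k).
  have d2 := der_exp d1.
  have d3 := derM (der_powR al k0) (derM (der_onem_powR be k1) d2).
  move: d3; rewrite (_ : (fun t => _) = F); last first.
    by apply/funext => t; rewrite /F; congr (_ * (_ * expR _)); field.
  move/der_eq; apply.
  rewrite /f !beta_kernelS// /beta_kernel.
  have e1 : k `^ al = k * k `^ (al - 1) by rewrite mulr_powRB1// ltW.
  have e2 : (1 - k) `^ be = (1 - k) * (1 - k) `^ (be - 1).
    by rewrite mulr_powRB1// subr_ge0 ltW.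
  rewrite e1 e2 (_ : - (w / 2) * k = - (k * w / 2)); last by field.
  by field.
have cK (al' k : R) : 0 < k < 1 -> {for k, continuous (beta_kernel al' w)}.
  move=> /andP[k0 k1].
  have d1 := derM (der_cst (- (w / 2)) k) (der_id k).
  have d2 := derM (derM (der_powR (al' - 1) k0) (der_onem_powR (be - 1) k1)) (der_exp d1).
  have := der_continuous d2.
  rewrite (_ : (fun t => _) = beta_kernel al' w)//.
  by apply/funext => t; rewrite /beta_kernel; congr (_ * expR _); field.
have fi : mu.-integrable `]0, 1[ (EFin \o f).
  rewrite (_ : EFin \o f = (fun k =>
    (al%:E * (EFin \o beta_kernel al w) k -
    (al + be)%:E * (EFin \o beta_kernel (al + 1) w) k) -
    (w / 2)%:E * ((EFin \o beta_kernel (al + 1) w) k -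
      (EFin \o beta_kernel (al + 1 + 1) w) k))%E)//.
  apply: integrableB => //.
    by apply: integrableB => //; apply: integrableZl.
  by apply: integrableZl => //; apply: integrableB.
have F0 (u : nat -> R) (C : R) : (forall n, 0 <= F (u n) <= C * n.+1%:R^-1) ->
    F (u n) @[n --> \oo] --> (0 : R).
  move=> uK; apply: (@squeeze_cvgr _ _ _ _ (fun n => 0) (fun n => C * n.+1%:R^-1)).
  - exact: nearW.
  - exact: cvg_cst.
  - rewrite -[X in _ --> X](mulr0 C); apply: cvgM; first exact: cvg_cst.
    exact: cvg_harmonic.
have Fge0 k : 0 <= F k by rewrite !mulr_ge0 ?powR_ge0 ?expR_ge0.
have e_le (k : R) : 0 <= k <= 1 -> expR (- (k * w / 2)) <= expR (`|w| / 2).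
  move=> /andP[k0 k1]; rewrite ler_expR -mulNr ler_pM2r ?invr_gt0//.
  by rewrite (le_trans (ler_norm _))// normrN normrM (ger0_norm k0) ler_piMl.
have pow_le1 (a x : R) : 0 <= a -> 0 <= x <= 1 -> x `^ a <= 1.
  move=> a0 /andP[x0 x1]; have /= := @ge0_ler_powR _ a a0 x 1.
  by rewrite !nnegrE powR1; apply.
have i31 n : (n.+3%:R^-1 : R) <= n.+1%:R^-1 by rewrite lef_pV2 ?posrE// ler_nat ltnS -addn2 leq_addr.
have i01 n : 0 < (n.+3%:R^-1 : R) < 1.
  by have /andP[-> h] := ivn n; rewrite (le_lt_trans h)// invf_lt1// ltr1n.
have b01 n : 0 < beta_bound n < 1.
  have /andP[a ->] := beta_boundP n; rewrite andbT (lt_le_trans _ a)//.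
  by have /andP[_ i1'] := i01 n; rewrite subr_gt0.
(* Starting at [n.+3] makes this hold for every [n]: the left side is at most 1/3 and the right side
   at least 2/3. *)
have ab n : (n.+3%:R^-1 : R) < beta_bound n.
  have /andP[a _] := beta_boundP n; rewrite (lt_le_trans _ a)//.
  by have /andP[_] := ivn n; move: (n.+3%:R^-1 : R) => t; lra.
have := @integral_derive_zero R `]0, 1[ F f (fun n => n.+3%:R^-1) beta_bound 0
  m01 ab.
move=> /(_ _ _ _ _ fi) ibp.
have if0 : (\int[mu]_(k in `]0%R, 1%R[) (f k)%:E = 0)%E.
  apply: ibp.
  - move=> n k /=; rewrite !in_itv/= => /andP[nk kn].
    have /andP[i0 _] := i01 n; have /andP[_ b1] := b01 n.
    by rewrite (lt_le_trans i0)//= (le_lt_trans kn).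
  - move=> k; rewrite /= in_itv/= => /andP[k0 k1].
    have h1 := beta_bound_near k1.
    have h2 : \forall n \near \oo, (n.+3%:R^-1 : R) <= k.
      exists (Num.truncn k^-1).+1 => // n /= kn.
      rewrite -[leRHS]invrK lef_pV2 ?posrE ?invr_gt0//.
      apply: ltW; apply: (lt_le_trans (truncnS_gt _)).
      by rewrite ler_nat (leq_trans kn)// -addn3 leq_addr.
    near=> n; rewrite /= in_itv/=; apply/andP; split; near: n; [exact: h2|exact: h1].
  - move=> k; rewrite /= in_itv/= => k01.
    apply: cvgB; last first.
      by apply: cvgM; [exact: cvg_cst|apply: cvgB; exact: cK].
    by apply: cvgB; apply: cvgM; [exact: cvg_cst|exact: cK|exact: cvg_cst|exact: cK].
  - apply: (F0 _ (expR (`|w| / 2))) => n; rewrite Fge0/=.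
    have /andP[i0 i1'] := i01 n.
    rewrite /F [leRHS]mulrC; apply: ler_pM; rewrite ?mulr_ge0 ?powR_ge0 ?expR_ge0//.
      by rewrite (le_trans _ (i31 n))//; apply: ge1r_powR => //; rewrite i0 ltW.
    rewrite -[leRHS]mul1r; apply: ler_pM; rewrite ?powR_ge0 ?expR_ge0//.
      apply: pow_le1; first exact: ltW.
      by rewrite subr_ge0 (ltW i1')/= lerBlDr lerDl (ltW i0).
    by apply: e_le; rewrite (ltW i0) (ltW i1').
  - apply: (F0 _ (expR (`|w| / 2))) => n; rewrite Fge0/=.
    have /andP[i0 i1'] := b01 n.
    rewrite /F beta_bound_powR mulrCA [leRHS]mulrC.
    apply: ler_pM; rewrite ?mulr_ge0 ?powR_ge0 ?expR_ge0 ?invr_ge0//.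
    rewrite -[leRHS]mul1r; apply: ler_pM; rewrite ?powR_ge0 ?expR_ge0//.
      apply: pow_le1; first exact: ltW.
      by rewrite (ltW i0) (ltW i1').
    by apply: e_le; rewrite (ltW i0) (ltW i1').
have Rf0 : \int[mu]_(k in `]0, 1[) f k = 0 by rewrite /Rintegral if0.
move: Rf0; rewrite /f RintegralB//; last 2 first.
- rewrite (_ : EFin \o _ = (fun k =>
    (al%:E * (EFin \o beta_kernel al w) k -
    (al + be)%:E * (EFin \o beta_kernel (al + 1) w) k))%E)//.
  by apply: integrableB => //; apply: integrableZl.
- rewrite (_ : EFin \o _ = (fun k =>
    (w / 2)%:E * ((EFin \o beta_kernel (al + 1) w) k -
      (EFin \o beta_kernel (al + 1 + 1) w) k))%E)//.
  by apply: integrableZl => //; apply: integrableB.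
rewrite RintegralB//; last 2 first.
- rewrite (_ : EFin \o _ = (fun k => al%:E * (EFin \o beta_kernel al w) k)%E)//.
  exact: integrableZl.
- rewrite (_ : EFin \o _ = (fun k => (al + be)%:E * (EFin \o beta_kernel (al + 1) w) k)%E)//.
  exact: integrableZl.
rewrite !RintegralZl//; last first.
  rewrite (_ : EFin \o _ = (fun k => (EFin \o beta_kernel (al + 1) w) k -
      (EFin \o beta_kernel (al + 1 + 1) w) k)%E)//.
  exact: integrableB.
rewrite RintegralB// -!/(beta_laplace _ w) => /eqP; rewrite subr_eq0 => /eqP ->.
by rewrite (_ : al + 2 = al + 1 + 1)// -addrA.
Unshelve. all: end_near. Qed.

End beta_laplace.

(** For large [v] the recurrence at [j] does not suffice alone, so the bound at [j.+1] is used as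
    well. This descends from an index so large that the bound is direct. *)
Lemma laplace_ratio_bound (R : realType) (A b v : R) (I : nat -> R) :
  0 < A -> 0 < b <= 1 -> 0 <= v ->
  (forall j, 0 < I j) -> (forall j, I j.+1 <= I j) ->
  (forall j, v * (I j.+1 - I j.+2) = (A + j%:R) * I j - (A + j%:R + b) * I j.+1) ->
  forall j, b * v * I j.+1 <= (A + j%:R) * I j.
Proof.
move=> A0 /andP[b0 b1] v0 I0 Id rec.
have small j : (A + j%:R + b) * I j.+1 <= (A + j%:R) * I j.
  by rewrite -subr_ge0 -rec mulr_ge0// subr_ge0.
have B0 j : 0 < A + j%:R by rewrite ltr_pwDl.
(* [small] at [j.+1] eliminates [I j.+2] from the recurrence; the assumption on [v] then gives the
   sign. *)
have direct j : b * v <= A + j.+1%:R + b -> b * v * I j.+1 <= (A + j%:R) * I j.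
  move=> vj; have := rec j; have := small j.+1; have := B0 j; have := I0 j.+1.
  move: vj; rewrite -natr1 addrA; set B := A + j%:R; set x := I j; set y := I j.+1.
  set z := I j.+2 => vj y0 B1 zy e.
  have v1 : v * ((B + 1 + b) * z) <= v * ((B + 1) * y) by rewrite ler_wpM2l.
  have v2 : b * v * ((B + b) * y) <= (B + 1 + b) * ((B + b) * y).
    by rewrite ler_wpM2r// mulr_ge0 ?ltW// addr_gt0.
  rewrite -subr_ge0 -(pmulr_rge0 _ (_ : 0 < B + 1 + b)); last first.
    by rewrite addr_gt0// addr_gt0.
  have -> : (B + 1 + b) * (B * x - b * v * y) =
     (B + 1 + b) * (B + b) * y + (B + 1 + b) * (v * y - b * v * y) - v * ((B + 1 + b) * z).
    have -> : B * x = v * (y - z) + (B + b) * y by rewrite e subrK.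
    by ring.
  have : (B + 1 + b) * (v * y - b * v * y) - v * ((B + 1) * y) = - (b * v * ((B + b) * y)).
    by ring.
  by lra.
have step j : b * v * I j.+2 <= (A + j.+1%:R) * I j.+1 ->
    b * v * I j.+1 <= (A + j%:R) * I j.
  have [vj _|vj h] := leP (b * v) (A + j.+1%:R + b); first exact: direct.
  have := rec j; have := B0 j; have := I0 j.+1.
  move: vj h; rewrite -natr1 addrA; set B := A + j%:R; set x := I j; set y := I j.+1.
  set z := I j.+2 => vj h y0 B1 e.
  have v1 : (1 - b) * ((B + 1 + b) * y) <= (1 - b) * (b * v * y).
    by rewrite ler_wpM2l ?subr_ge0// ler_pM2r// ltW.
  (* Multiplied by [b], the recurrence contains [b * v * z], which the bound at [j.+1] controls. As
     [b <= 1], the lower bound on [b * v] applies to the term with factor [1 - b], and the remaining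
     coefficients cancel exactly. *)
  rewrite -subr_ge0 -(pmulr_rge0 _ b0).
  have -> : b * (B * x - b * v * y) = b * (B + b) * y + (1 - b) * (b * v * y) - b * v * z.
    have -> : B * x = v * (y - z) + (B + b) * y by rewrite e subrK.
    by ring.
  have : b * (B + b) * y + (1 - b) * ((B + 1 + b) * y) = (B + 1) * y by ring.
  by lra.
move=> j; pose N := (Num.truncn (b * v)).+1.
have base : b * v * I (j + N).+1 <= (A + (j + N)%:R) * I (j + N)%N.
  apply: direct; apply: (le_trans (ltW (truncnS_gt _))).
  rewrite -/N -addrA [A + _]addrC -addrA -[leLHS]addr0; apply: lerD.
    by rewrite ler_nat (leq_trans (leq_addl j N)).
  by rewrite addr_ge0// ltW.
elim: N base => [|N ih]; first by rewrite addn0.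
by rewrite addnS => h; apply: ih; exact: step.
Qed.

(** Here [x], [y], [z] stand for I_0, I_1, I_2 at [w] and [P] for the dimension; the conclusion is
    Stein's expression multiplied by [x ^+ 2]. *)
Lemma shrinkage_superharmonic (R : realType) (P A b w x y z : R) :
  0 < x -> 0 < y -> 0 <= w -> 0 < b -> 0 < A ->
  w / 2 * (y - z) = A * x - (A + b) * y -> z <= y ->
  b * (w / 2) * z <= (A + 1) * y ->
  2 * (A + 1) <= b * (P + A) -> A + 2 * b <= P ->
  2 * w * z * x - 2 * P * y * x - w * y ^+ 2 <= 0.
Proof.
move=> x0 y0 w0 b0 A0 e zy h2 hc hq.
have D0 : 0 <= A * x - (A + b) * y by rewrite -e mulr_ge0 ?divr_ge0// subr_ge0.
have Ab : 0 < A + b by rewrite addr_gt0.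
have xy : 0 < y * x by rewrite mulr_gt0.
have [h|h] := leP (2 * A * x) (w * y).
  have h3 : w * z * x <= (P + A) * (y * x).
    rewrite -(ler_pM2l b0).
    have k1 : b * (w / 2) * z * (2 * x) <= (A + 1) * y * (2 * x).
      by rewrite ler_pM2r// mulr_gt0.
    have k2 : 2 * (A + 1) * (y * x) <= b * (P + A) * (y * x) by rewrite ler_pM2r.
    have -> : b * (w * z * x) = b * (w / 2) * z * (2 * x) by field.
    rewrite (le_trans k1)//.
    have -> : (A + 1) * y * (2 * x) = 2 * (A + 1) * (y * x) by ring.
    by rewrite [leRHS]mulrA.
  have h4 : 2 * A * x * y <= w * y * y by rewrite ler_pM2r.
  have -> : 2 * w * z * x - 2 * P * y * x - w * y ^+ 2 =
    2 * (w * z * x) - 2 * (P * (y * x)) - w * y * y by ring.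
  have : 2 * A * x * y = 2 * (A * (y * x)) by ring.
  move: h3; rewrite mulrDl; lra.
(* In this case the recurrence is used to eliminate [z] altogether. *)
have wz : w * z = w * y - 2 * A * x + 2 * (A + b) * y.
  have : w * z = w * y - 2 * (w / 2 * (y - z)) by field.
  by rewrite e => ->; ring.
have -> : 2 * w * z * x - 2 * P * y * x - w * y ^+ 2 =
    - (2 * x * (2 * A * x - w * y)) + y * (4 * (A + b) * x - 2 * P * x - w * y).
  have -> : 2 * w * z * x = 2 * x * (w * z) by ring.
  by rewrite wz; ring.
set Q := 4 * (A + b) * x - _ - _.
have S0 : 0 <= 2 * A * x - w * y by rewrite subr_ge0 ltW.
have xS : 0 <= 2 * x * (2 * A * x - w * y) by rewrite mulr_ge0// mulr_ge0// ltW.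
have [Q0|Q0] := leP Q 0.
  have : y * Q <= 0 by rewrite pmulr_rle0.
  by lra.
(* When [Q > 0], the factor [A + b] allows [(A + b) * y] to be replaced by the larger [A * x]; what
   remains is minus a sum of nonnegative terms, the last of them by [A + 2 * b <= P]. *)
rewrite -(pmulr_rle0 _ Ab).
have k1 : 0 <= (A * x - (A + b) * y) * Q by rewrite mulr_ge0// ltW.
have k2 : 0 <= x * ((A + 2 * b) * (2 * A * x - w * y)).
  by rewrite mulr_ge0 ?(ltW x0)// mulr_ge0// addr_ge0 ?mulr_ge0// ltW.
have k3 : 0 <= 2 * A * x * x * (P - (A + 2 * b)).
  by rewrite mulr_ge0 ?subr_ge0// !mulr_ge0// ltW.
have : (A + b) * (- (2 * x * (2 * A * x - w * y)) + y * Q) =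
   - ((A * x - (A + b) * y) * Q) - x * ((A + 2 * b) * (2 * A * x - w * y))
   - 2 * A * x * x * (P - (A + 2 * b)).
  by rewrite /Q; ring.
by lra.
Qed.

(** * The posterior mean of kappa as a function of the squared norm *)

Section shrinkage_factor.
Variables (R : realType) (A b : R).
Hypothesis A1 : 1 <= A.
Hypothesis b01 : 0 < b <= 1.

Let A0 : 0 < A. Proof. exact: lt_le_trans A1. Qed.
Let b0 : 0 < b. Proof. by case/andP: b01. Qed.

Let J (j : nat) (w : R) := beta_laplace b (A + j%:R) w.

Let Aj (j : nat) : 1 <= A + j%:R.
Proof. by rewrite (le_trans A1)// lerDl. Qed.

Let J_gt0 j w : 0 < J j w.
Proof. exact: beta_laplace_gt0. Qed.

Let J_leS j w : J j.+1 w <= J j w.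
Proof. by rewrite /J -natr1 addrA; exact: beta_laplace_leS. Qed.

Let J_rec j w :
  w / 2 * (J j.+1 w - J j.+2 w) = (A + j%:R) * J j w - (A + j%:R + b) * J j.+1 w.
Proof.
rewrite /J (_ : A + j.+1%:R = A + j%:R + 1); last by rewrite -natr1 addrA.
rewrite (_ : A + j.+2%:R = A + j%:R + 2); last by rewrite -addn2 natrD addrA.
exact: beta_laplace_recurrence.
Qed.

Let J_der j (w : R) : is_derive w 1 (J j) (- (J j.+1 w / 2)).
Proof. by rewrite /J -natr1 addrA; exact: derive_beta_laplace. Qed.

Let J_cont j : continuous (J j).
Proof. by move=> w; exact: (der_continuous (J_der j w)). Qed.

Let J_bound (w : R) : 0 <= w -> forall j, b * (w / 2) * J j.+1 w <= (A + j%:R) * J j w.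
Proof.
move=> w0; apply: (@laplace_ratio_bound _ A b (w / 2) (J ^~ w)) => //.
by rewrite divr_ge0.
Qed.

Definition shrinkage (w : R) : R := J 1 w / J 0 w.

(** Minus half the posterior variance of kappa, as [J j] has derivative [- J j.+1 / 2]. *)
Definition shrinkage' (w : R) : R :=
  (J 1 w ^+ 2 - J 2 w * J 0 w) / (2 * J 0 w ^+ 2).

Lemma derive_shrinkage (w : R) : is_derive w 1 shrinkage (shrinkage' w).
Proof.
have J0 : J 0 w != 0 by rewrite gt_eqF.
have dV : is_derive w 1 (fun t => (J 0 t)^-1) (- (J 0 w) ^- 2 * - (J 1 w / 2)).
  have [dJ eJ] := J_der 0 w; apply: DeriveDef; first exact: derivableV.
  by rewrite deriveV// eJ.
have := derM (J_der 1 w) dV.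
move/der_eq; apply; rewrite /shrinkage'; move: J0 {dV}.
by move: (J 0 w) (J 1 w) (J 2 w) => x y z x0; field.
Qed.

Lemma continuous_shrinkage' : continuous shrinkage'.
Proof.
move=> w; apply: cvgM.
  apply: cvgB.
    rewrite (_ : (fun t => _) = (fun t => J 1 t * J 1 t)); last first.
      by apply/funext => t; rewrite expr2.
    by rewrite expr2; apply: cvgM; exact: J_cont.
  by apply: cvgM; exact: J_cont.
apply: cvgV; first by rewrite mulf_neq0// expf_neq0// gt_eqF.
rewrite (_ : (fun t => _) = (fun t => 2 * (J 0 t * J 0 t))); last first.
  by apply/funext => t; rewrite expr2.
by rewrite expr2; apply: cvgM; [exact: cvg_cst|apply: cvgM; exact: J_cont].
Qed.

Lemma shrinkage01 (w : R) : 0 <= shrinkage w <= 1.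
Proof.
rewrite /shrinkage (divr_ge0 (ltW (J_gt0 _ _)) (ltW (J_gt0 _ _)))/=.
by rewrite ler_pdivrMr// mul1r J_leS.
Qed.

Lemma shrinkage_bound (w : R) : 0 <= w -> w * shrinkage w <= 2 * A / b.
Proof.
move=> w0; rewrite /shrinkage mulrA ler_pdivrMr// -(ler_pM2l b0).
have := J_bound w0 0; rewrite addr0; move: (J 0 w) (J 1 w) => x y h.
have -> : b * (w * y) = 2 * (b * (w / 2) * y) by field.
have -> : b * (2 * A / b * x) = 2 * (A * x) by field; rewrite gt_eqF.
by rewrite ler_pM2l.
Qed.

(** Both [J 1 w ^+ 2] and [J 2 w * J 0 w] lie between 0 and [J 1 w * J 0 w], because [J] decreases
    in its index. *)
Lemma shrinkage'_bound (w : R) : `|shrinkage' w| <= shrinkage w.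
Proof.
rewrite /shrinkage' /shrinkage normrM normfV [`|2 * _|]ger0_norm; last first.
  by rewrite mulr_ge0// sqr_ge0.
rewrite ler_pdivrMr ?mulr_gt0 ?exprn_gt0//.
have := J_leS 1 w; have := J_leS 0 w; have := J_gt0 2 w; have := J_gt0 1 w.
have := J_gt0 0 w; move: (J 0 w) (J 1 w) (J 2 w) => x y z x0 y0 z0 yx zy.
have -> : y / x * (2 * x ^+ 2) = 2 * (y * x) by field; rewrite gt_eqF.
have h1 : y ^+ 2 <= y * x by rewrite expr2 ler_pM2l.
have h2 : z * x <= y * x by rewrite ler_pM2r.
have h3 : 0 <= y ^+ 2 by exact: sqr_ge0.
have h4 : 0 < z * x by rewrite mulr_gt0.
by rewrite ler_norml; apply/andP; split; lra.
Qed.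

Lemma shrinkage_sure (P w : R) : 0 <= w ->
  2 * (A + 1) <= b * (P + A) -> A + 2 * b <= P ->
  - 2 * P * shrinkage w - 4 * w * shrinkage' w + w * shrinkage w ^+ 2 <= 0.
Proof.
move=> w0 hc hq.
have J0 : 0 < J 0 w by [].
have e := J_rec 0 w; rewrite addr0 in e.
have h2 := J_bound w0 1.
have := @shrinkage_superharmonic _ P A b w _ _ _ (J_gt0 0 w) (J_gt0 1 w) w0 b0 A0
  e (J_leS 1 w) h2 hc hq.
rewrite /shrinkage /shrinkage'; move: J0 {e h2}; move: (J 0 w) (J 1 w) (J 2 w).
move=> x y z x0 h.
have <- : (2 * w * z * x - 2 * P * y * x - w * y ^+ 2) / x ^+ 2 =
    - 2 * P * (y / x) - 4 * w * ((y ^+ 2 - z * x) / (2 * x ^+ 2)) + w * (y / x) ^+ 2.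
  by field; rewrite gt_eqF.
by rewrite pmulr_lle0// invr_gt0 exprn_gt0.
Qed.

End shrinkage_factor.

(** * The constant [a_star] and the theorem *)

(** [a_star] is a root of the quadratic a^2 + (3p/2 - 2) a - (p + 2), that is, the case of equality
    in the last condition of [admissible]. *)
Lemma a_star_root (R : realType) (p : nat) :
  a_star R p * (3 * p%:R / 2 + a_star R p) = p%:R + 2 * a_star R p + 2.
Proof.
set q : R := p%:R.
have D0 : 0 <= 9 * q ^+ 2 - 8 * q + 48.
  have := sqr_ge0 (q - 1); have := sqr_ge0 q.
  have -> : (q - 1) ^+ 2 = q ^+ 2 - 2 * q + 1 by ring.
  lra.
have := sqr_sqrtr D0; rewrite /a_star -/q; set S := Num.sqrt _ => e.
have -> : (- 3 * q + 4 + S) / 4 * (3 * q / 2 + (- 3 * q + 4 + S) / 4) =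
  (S ^+ 2 - 9 * q ^+ 2 + 16 + 8 * S) / 16 by field.
by rewrite e; field.
Qed.

Lemma a_star_itv (R : realType) (p : nat) : (7 <= p)%N -> 0 < a_star R p < 1.
Proof.
move=> p7; have q7 : 7 <= p%:R :> R by rewrite (ler_nat _ 7).
have := a_star_root R p.
(* This singles out the larger root; the root equation alone also admits a negative one. *)
have S0 : 0 <= 4 * a_star R p + 3 * p%:R - 4.
  rewrite /a_star; set S := Num.sqrt _; have : 0 <= S by exact: sqrtr_ge0.
  by rewrite mulrC divfK//; lra.
move: q7 S0; set q : R := p%:R; set a := a_star R p => q7 S0 e.
apply/andP; split; rewrite ltNge; apply/negP => h.
  have : 0 <= - a * (3 * q / 2 + a - 2) by rewrite mulr_ge0//; lra.
  have -> : - a * (3 * q / 2 + a - 2) = 2 * a - a * (3 * q / 2 + a) by ring.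
  rewrite e; lra.
(* By the root equation this product equals [3 - q / 2], which is negative exactly when the
   dimension exceeds 6. *)
have : 0 <= (a - 1) * (3 * q / 2 + a - 1) by rewrite mulr_ge0//; lra.
have -> : (a - 1) * (3 * q / 2 + a - 1) = a * (3 * q / 2 + a) - 2 * a - 3 * q / 2 + 1.
  by ring.
rewrite e; lra.
Qed.

Lemma a_star_admissible (R : realType) (p : nat) : (7 <= p)%N ->
  admissible p (a_star R p).
Proof.
move=> p7; have q7 : 7 <= p%:R :> R by rewrite (ler_nat _ 7).
have a01 := a_star_itv R p7; have /andP[a0 a1] := a01.
split => //; first by apply/andP; split; lra.
by rewrite a1 andbT ler_pdivrMr ?a_star_root//; lra.
Qed.

(** The quadratic is nonnegative at an admissible [a] and zero at [s], and its increment from [a] to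
    [s] is [s - a] times the positive factor [3 * q / 2 + s + a - 2]. *)
Lemma a_star_min (R : realType) (p : nat) (a : R) : (7 <= p)%N ->
  admissible p a -> a_star R p <= a.
Proof.
move=> p7 [/andP[a0 _] _ /andP[h _]].
have q7 : 7 <= p%:R :> R by rewrite (ler_nat _ 7).
have /andP[s0 _] := a_star_itv R p7.
have := a_star_root R p; move: h; rewrite ler_pdivrMr; last by lra.
move: q7 s0; set q : R := p%:R; set s := a_star R p => q7 s0 h e.
rewrite leNgt; apply/negP => lt.
have : 0 < (s - a) * (3 * q / 2 + s + a - 2) by rewrite mulr_gt0//; lra.
have -> : (s - a) * (3 * q / 2 + s + a - 2) =
  s * (3 * q / 2 + s) - a * (3 * q / 2 + a) - 2 * s + 2 * a by ring.
rewrite e; lra.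
Qed.

Lemma kappa_int_beta_laplace (R : realType) (p : nat) (a q : R) (y : vec R p) :
  kappa_int (fun k : R => k `^ (a - 1) * (1 - k) `^ (a - 1)) q y =
  beta_laplace a (q + a) (sqnorm y).
Proof.
apply: eq_Rintegral => k /[!inE]/=; rewrite in_itv/= => /andP[k0 k1].
rewrite /beta_kernel -(addrA q) (@powRD _ _ q).
  by ring.
by rewrite (gt_eqF k0) implybT.
Qed.

Theorem mainTheorem3 (R : realType) (p : nat) :
  (7 <= p)%N ->
  0 < a_star R p < 1 /\
  (admissible p (a_star R p) /\
   forall a : R, admissible p a -> a_star R p <= a) /\
  minimax (@bayes_estimator R p
    (fun k : R => k `^ (a_star R p - 1) * (1 - k) `^ (a_star R p - 1))).
Proof.
move=> p7; split; first exact: a_star_itv.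
split; first by split; [exact: a_star_admissible|move=> a; exact: a_star_min].
set a := a_star R p; set A : R := p%:R / 2 + a.
have q7 : 7 <= p%:R :> R by rewrite (ler_nat _ 7).
have /andP[a0 a1] : 0 < a < 1 := a_star_itv R p7.
have A1 : 1 <= A by rewrite /A; lra.
have b01 : 0 < a <= 1 by rewrite a0 ltW.
have root := a_star_root R p; rewrite -/a in root.
(* An equality at [a_star], by the root equation. *)
have hc : 2 * (A + 1) <= a * (p%:R + A).
  have -> : a * (p%:R + A) = a * (3 * p%:R / 2 + a) by rewrite /A; field.
  by rewrite root /A; lra.
have hq : A + 2 * a <= p%:R by rewrite /A; lra.
have -> : bayes_estimator (fun k : R => k `^ (a - 1) * (1 - k) `^ (a - 1)) =
    (fun y : vec R p => vscale (1 - shrinkage A a (sqnorm y)) y).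
  apply/funext => y; rewrite /bayes_estimator !kappa_int_beta_laplace.
  by rewrite /shrinkage addr0 -/A addrAC.
have dphi := derive_shrinkage A1 b01.
split.
  apply: measurable_vscale; last exact: measurable_id.
  apply: measurable_funB => //; apply: measurableT_comp; last exact: measurable_sqnorm.
  by apply: continuous_measurable_fun => w; exact: (der_continuous (dphi w)).
(* Every estimator has supremum risk at least p, so it remains to bound the Bayes risk by p at each
   parameter. *)
move=> delta mdelta; apply: le_trans (sup_risk_ge mdelta).
apply: ge_ereal_sup => _ [b _ <-].
apply: (@shrinkage_risk_le _ _ (shrinkage' A a) (2 * A / a)) => //.
- exact: continuous_shrinkage'.
- by move=> w _; exact: shrinkage01.
- by move=> w; exact: shrinkage_bound.
- by move=> w _; exact: shrinkage'_bound.
- by move=> w w0; exact: shrinkage_sure.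
Qed.
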